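(* Any finite-dimensional anticommutative Engel algebra over $\mathbf{k}$ of level not greater than five is nilpotent.
   Context: $\mathbf{k}$ is a fixed algebraically closed field. An algebra is a $\mathbf{k}$-vector space with a bilinear multiplication (not necessarily associative). $A$ is anticommutative if $a^2=0$ for all $a\in A$; $A$ is Engel if there is $m>0$ with $(L_a)^m=0$ for all $a\in A$, where $L_a(b)=ab$. $A$ is nilpotent if $A^m=0$ for some $m$, where $A^1=A$ and $A^i=A(A^{i-1})+(A^{i-1})A$ for $i>1$ (products of subspaces are the spans of products of elements). Degenerations and level. Fix an $n$-dimensional space $V$ and let $\mathcal{A}_n=\mathrm{Hom}(V\otimes V,V)\cong\mathbf{k}^{n^3}$ (Zariski topology), with $GL(V)$ acting by $(g*\mu)(x\otimes y)=g\mu(g^{-1}x\otimes g^{-1}y)$. A structure $\mu\in\mathcal{A}_n$ represents $A$ if $A\cong(V,\mu)$. For $n$-dimensional algebras $A,B$ represented by $\mu,\chi$, write $A\to B$ if $\chi$ lies in the closure of the orbit $O(\mu)$; the degeneration is non-trivial if $A\not\cong B$. The level $lev(A)$ is the maximal $m$ such that there is a chain of non-trivial degenerations $A\to A_{m-1}\to\dots\to A_1\to A_0$ of $n$-dimensional algebras. *)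

(* Defs.v *)
From HB Require Import structures.
From mathcomp Require Import all_boot all_order all_algebra.
From mathcomp Require Import mpoly.

Set Implicit Arguments.
Unset Strict Implicit.
Unset Printing Implicit Defensive.

Import GRing.Theory.
Local Open Scope ring_scope.

(* Bilinear maps V x V -> V, curried: Hom(V (x) V, V) = Hom(V, Hom(V, V)).    *)
Definition structure (k : fieldType) (V : vectType k) : vectType k :=
  'Hom(V, 'Hom(V, V)).

(* Neither associativity nor a unit is required, so this is not an falgType.  *)
Record algebra (k : fieldType) : Type := Algebra {
  space :> vectType k;
  mul : structure space
}.

Section AlgebraProperties.

Variables (k : fieldType) (A : algebra k).
Implicit Types (a b : A) (U V W : {vspace A}).

Definition left_mul a : 'End(A) := mul A a.

Definition anticommutative : Prop := forall a, mul A a a = 0.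

Definition engel : Prop :=
  exists2 m : nat, (0 < m)%N & forall a b, iter m (left_mul a) b = 0.

(* The span of the products u v with u in U and v in V. It is computed on     *)
(* bases, like prodv in falgebra; see mul_spaceP.                             *)
Definition mul_space U V : {vspace A} :=
  (<<[seq mul A u v | u <- vbasis U, v <- vbasis V]>>)%VS.

Lemma mul_spaceP U V W :
  reflect (forall u v, u \in U -> v \in V -> mul A u v \in W)
          (mul_space U V <= W)%VS.
Proof.
apply: (iffP span_subvP) => [sW u v Uu Vv | sW w /allpairsP[[u v] /= [Uu Vv ->]]].
  rewrite (coord_vbasis Uu) linear_sum sum_lfunE memv_suml // => i _.
  rewrite linearZ scale_lfunE memvZ // (coord_vbasis Vv) linear_sum.
  rewrite memv_suml // => j _; rewrite linearZ memvZ //.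
  by apply: sW; apply: allpairs_f; apply: mem_nth; rewrite size_tuple.
by apply: sW; [apply: vbasis_mem Uu | apply: vbasis_mem Vv].
Qed.

(* A^i for i > 0 (A^0 is a dummy value).                                      *)
Definition power (i : nat) : {vspace A} :=
  iter i.-1 (fun U => mul_space fullv U + mul_space U fullv)%VS fullv.

Definition nilpotent : Prop :=
  exists2 m : nat, (0 < m)%N & power m = 0%VS.

End AlgebraProperties.

Definition isomorphic (k : fieldType) (A B : algebra k) : Prop :=
  exists2 f : 'Hom(A, B), bijective f &
    forall x y, f (mul A x y) = mul B (f x) (f y).

Section Zariski.

Variables (k : fieldType) (W : vectType k).

(* Polynomial functions on W, in coordinates; the set of these functions, and *)
(* hence the topology, does not depend on the basis.                          *)
Definition poly_fun (p : {mpoly k[\dim {:W}]}) (w : W) : k :=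
  p.@[fun i => coord (vbasis {:W}) i w].

Definition zariski_closed (C : W -> Prop) : Prop :=
  exists I : {mpoly k[\dim {:W}]} -> Prop,
    forall w, C w <-> (forall p, I p -> poly_fun p w = 0).

Definition zariski_closure (S : W -> Prop) (w : W) : Prop :=
  forall C, zariski_closed C -> (forall v, S v -> C v) -> C w.

End Zariski.

(* chi lies in O(mu), the orbit of mu under GL(V).                            *)
Definition orbit (k : fieldType) (V : vectType k) (mu chi : structure V) : Prop :=
  exists2 g : 'End(V), bijective g &
    forall x y, chi x y = g (mu ((g^-1)%VF x) ((g^-1)%VF y)).

Definition represents (k : fieldType) (V : vectType k) (mu : structure V)
    (A : algebra k) : Prop :=
  isomorphic A (Algebra mu).

(* A -> B. The representatives mu and chi are unique up to the action of      *)
(* GL(V), so their choice is irrelevant; that chi exists forces B to have the *)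
(* same dimension as A.                                                       *)
Definition degenerates (k : fieldType) (A B : algebra k) : Prop :=
  exists mu chi : structure 'rV[k]_(\dim {:A}),
    [/\ represents mu A, represents chi B & zariski_closure (orbit mu) chi].

(* There are m successive non-trivial degenerations starting from A.          *)
Fixpoint degeneration_chain (k : fieldType) (m : nat) (A : algebra k) : Prop :=
  if m is m'.+1 then
    exists B : algebra k,
      [/\ degenerates A B, ~ isomorphic A B & degeneration_chain m' B]
  else True.

Definition is_level (k : fieldType) (A : algebra k) (m : nat) : Prop :=
  degeneration_chain m A /\
  (forall m' : nat, degeneration_chain m' A -> (m' <= m)%N).

(* Main.v *)
(* A non-nilpotent anticommutative Engel algebra A is shown to start a chain of
   six non-trivial degenerations. Conjugating by the one-parameter group
   diag(s^w) and letting s tend to 0 degenerates A to the graded part of its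
   multiplication for the weight w; in this way, if a, u, L_a u, L_a^2 u, ... are
   linearly independent, A degenerates to the nilpotent algebra where one element
   acts by the Jordan blocks so obtained, and from there along the dominance
   order of partitions, the dimensions of the second and third powers telling the
   algebras apart. By the Engel condition a is never in the image of L_a, so the
   independence is easy to get.
   - If L_a^3 <> 0 for some a, there is a block of size 4; this gives six steps
     unless dim A = 5. In dimension 5 one further intermediate algebra is needed;
     it is available unless b (a b) is a combination of a, b, a b and a (a b) for
     all b with L_a^3 b <> 0, which forces A to be nilpotent.
   - If L_a^3 = 0 for all a and some L_a^2 has rank at least 2, there are two
     blocks of size 3.
   - Otherwise L_a^3 = 0 and L_a^2 has rank at most 1 for all a. Either all the
     L_a^2 have their image in a fixed line, or a (a x) = phi(a, x) v(a) with phi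
     bilinear alternating and v linear. In both cases there is an ideal U with
     L_a^2 A <= U and L_a^2 U = 0 for all a, and A is nilpotent: modulo U, and
     then on U, the L_a anticommute. *)
From HB Require Import structures.
From mathcomp Require Import all_boot all_order all_algebra.
From mathcomp Require Import ring zify.
From mathcomp Require mpoly.
From Stdlib Require Import Classical.
Require Import Defs.

Set Implicit Arguments.
Unset Strict Implicit.
Unset Printing Implicit Defensive.

Import GRing.Theory passmx.
Local Open Scope ring_scope.

(** * Polynomials vanishing off a finite set *)

Section InfiniteField.
Variable k : closedFieldType.

(** The product of [p] with all ['X - b%:P], [b] in [bad], vanishes everywhere; were it nonzero,
    adding 1 would give a nonconstant polynomial without roots. *)
Lemma poly_cofinite_roots (p : {poly k}) (bad : seq k) :
  (forall s, s \notin bad -> p.[s] = 0) -> p = 0.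
Proof.
move=> p0; set m := \prod_(b <- bad) ('X - b%:P).
have m0 : m != 0 by apply: monic_neq0; apply: monic_prod_XsubC.
have q0 s : (p * m).[s] = 0.
  rewrite hornerM; have [sb|/p0->] := boolP (s \in bad); last by rewrite mul0r.
  by rewrite (eqP (_ : root m s)) ?mulr0 // root_prod_XsubC.
apply/eqP; apply: contraT => pn0.
have qn0 : p * m != 0 by rewrite mulf_neq0.
have [sz|sz] := eqVneq (size (p * m + 1)) 1%N.
  have /size_poly1P[c _ e] : size (p * m + 1) == 1%N by apply/eqP.
  have : p * m = (c - 1)%:P by rewrite polyCB -e addrK.
  move=> e'; move: qn0 (q0 0); rewrite e' hornerC => + e''.
  by rewrite e'' eqxx.
have /closed_rootP[s] := sz.
by rewrite rootE hornerD q0 hornerC add0r oner_eq0.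
Qed.



(** The map [g] has kernel [W], and its coordinates along the curve are polynomials in [s] vanishing
    off [bad]. Below, this replaces passing to the limit [s = 0]. *)
Lemma memv_cofinite (V : vectType k) (W : {vspace V}) (bad : seq k) m
    (c : nat -> V) :
  (forall s, s \notin bad -> \sum_(i < m) s ^+ i *: c i \in W) ->
  forall i, (i < m)%N -> c i \in W.
Proof.
move=> cW i lt_im; set g := (\1 - projv W)%VF : 'End(V).
have gE v : (v \in W) = (g v == 0).
  rewrite add_lfunE opp_lfunE id_lfunE subr_eq0; apply/idP/eqP => [/projv_id //|->].
  exact: memv_proj.
rewrite gE; apply/eqP; rewrite [g _](coord_vbasis (memvf _)) big1 // => r _.
pose p := \poly_(j < m) coord (vbasis {:V}) r (g (c j)).
suffices p0 : p = 0 by have := coef0 k i; rewrite -p0 coef_poly lt_im => ->; rewrite scale0r.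
apply: (@poly_cofinite_roots _ bad) => s /cW; rewrite gE => /eqP e.
rewrite horner_poly -[RHS](linear0 (coord (vbasis {:V}) r)) -e !linear_sum.
by apply: eq_bigr => j _; rewrite !linearZ mulrC.
Qed.

End InfiniteField.

Lemma struct_scaleE (k : fieldType) (V : vectType k) a (mu : structure V) x y :
  (a *: mu) x y = a *: mu x y.
Proof.
rewrite (_ : (a *: mu) x = a *: (mu x : 'End(V))) ?scale_lfunE //.
Qed.

(** * Bilinear structures from structure constants *)

Section Structures.
Variables (k : fieldType) (n : nat).
Implicit Types (c : 'I_n -> 'I_n -> 'I_n -> k) (i j l : 'I_n).

Definition elem_row (j l : 'I_n) (y : 'rV[k]_n) : 'rV[k]_n :=
  y 0 j *: delta_mx 0 l.

Lemma elem_row_linear j l : linear (elem_row j l).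
Proof. by move=> a x y; rewrite /elem_row !mxE scalerDl scalerA. Qed.

HB.instance Definition _ j l :=
  GRing.isLinear.Build k _ _ _ (elem_row j l) (elem_row_linear j l).

Definition elem_hom i j l (x : 'rV[k]_n) : 'Hom('rV[k]_n, 'rV[k]_n) :=
  x 0 i *: linfun (elem_row j l).

Lemma elem_hom_linear i j l : linear (elem_hom i j l).
Proof. by move=> a x y; rewrite /elem_hom !mxE scalerDl scalerA. Qed.

HB.instance Definition _ i j l :=
  GRing.isLinear.Build k _ _ _ (elem_hom i j l) (elem_hom_linear i j l).

(** Writing [struct_of] as a combination of these elementary tensors makes its coordinates linear in
    the constants, as needed to restrict polynomials to a curve. *)
Definition elem_struct i j l : structure 'rV[k]_n := linfun (elem_hom i j l).

Definition struct_of c : structure 'rV[k]_n :=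
  \sum_i \sum_j \sum_l c i j l *: elem_struct i j l.

Lemma struct_ofE c x y :
  struct_of c x y = \sum_i \sum_j \sum_l (c i j l * x 0 i * y 0 j) *: delta_mx 0 l.
Proof.
rewrite /struct_of !sum_lfunE; apply: eq_bigr => i _.
rewrite !sum_lfunE; apply: eq_bigr => j _.
rewrite !sum_lfunE; apply: eq_bigr => l _.
rewrite struct_scaleE !lfunE /= /elem_hom !lfunE. by rewrite /= /elem_row !scalerA.
Qed.

Lemma struct_of_delta c i j :
  struct_of c (delta_mx 0 i) (delta_mx 0 j) = \sum_l c i j l *: delta_mx 0 l.
Proof.
rewrite struct_ofE (bigD1 i) //= [X in _ + X]big1 ?addr0 => [|i' ni]; last first.
  apply: big1 => j' _; apply: big1 => l _.
  by rewrite mxE (negPf ni) andbF mulr0 mul0r scale0r.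
rewrite (bigD1 j) //= [X in _ + X]big1 ?addr0 => [|j' nj]; last first.
  by apply: big1 => l _; rewrite [_ 0 j']mxE (negPf nj) andbF mulr0 scale0r.
by apply: eq_bigr => l _; rewrite !mxE !eqxx !mulr1.
Qed.

End Structures.

(** * Degeneration along a one-parameter diagonal group *)

Section WeightLimit.
Variables (k : closedFieldType) (n : nat) (w : nat -> nat).
Variable c : 'I_n -> 'I_n -> 'I_n -> k.
Implicit Types i j l : 'I_n.
Hypothesis cw : forall i j l, c i j l != 0 -> (w l <= w i + w j)%N.

Definition graded_part i j l := if w l == (w i + w j)%N then c i j l else 0.

(** The constants after rescaling the basis by powers of [s]. The exponent is a truncated
    difference, exact by [cw] wherever the constant is nonzero, so [s = 0] may be inserted and
    yields [graded_part]. *)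
Definition scaled_part s i j l := s ^+ (w i + w j - w l) * c i j l.

Definition weight_mx s : 'M[k]_n := diag_mx (\row_i s ^+ w i).

Lemma scaled_part0 : struct_of (scaled_part 0) = struct_of graded_part.
Proof.
apply: eq_bigr => i _; apply: eq_bigr => j _; apply: eq_bigr => l _.
congr (_ *: _); rewrite /scaled_part /graded_part expr0n subn_eq0.
have [->|nc] := eqVneq (c i j l) 0; first by rewrite mulr0 if_same.
by rewrite eqn_leq cw //=; case: leqP; rewrite ?mul1r ?mul0r.
Qed.

Lemma scaled_part_orbit (s : k) : s != 0 ->
  orbit (struct_of c) (struct_of (scaled_part s)).
Proof.
move=> s0.
have sw i : s ^+ w i != 0 by rewrite expf_neq0.
pose g := linfun (mulmxr (weight_mx s^-1)) : 'End('rV[k]_n).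
pose h := linfun (mulmxr (weight_mx s)) : 'End('rV[k]_n).
have gh : cancel h g.
  move=> x; rewrite !lfunE /= -mulmxA mulmx_diag.
  rewrite (_ : diag_mx _ = 1%:M) ?mulmx1 //; apply/matrixP => i j.
  by rewrite !mxE exprVn mulfV.
have hg : cancel g h.
  move=> x; rewrite !lfunE /= -mulmxA mulmx_diag.
  rewrite (_ : diag_mx _ = 1%:M) ?mulmx1 //; apply/matrixP => i j.
  by rewrite !mxE exprVn mulVf.
have bg : bijective g by exists h.
have gV : (g^-1)%VF =1 h.
  move=> x; rewrite -{1}[x]gh lker0_lfunK //; apply/lker0P; exact: can_inj hg.
have hE x i : h x 0 i = s ^+ w i * x 0 i.
  by rewrite lfunE /= mul_mx_diag !mxE mulrC.
have gE i : g (delta_mx 0 i) = s ^- w i *: delta_mx 0 i.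
  rewrite lfunE /=; apply/rowP => j; rewrite mul_mx_diag !mxE exprVn.
  by have [->|] := eqVneq j i; rewrite ?mulr1 ?mul1r // mul0r mulr0.
exists g => // x y; rewrite !gV !struct_ofE linear_sum; apply: eq_bigr => i _.
rewrite linear_sum; apply: eq_bigr => j _.
rewrite linear_sum; apply: eq_bigr => l _.
rewrite linearZ /= gE scalerA !hE; congr (_ *: _); rewrite /scaled_part.
have [->|/cw le] := eqVneq (c i j l) 0; first by rewrite !(mulr0, mul0r).
rewrite expfB_cond ?(negPf s0) ?add0n // exprD -!mulrA; ring.
Qed.

Definition scaled_poly i j l : {poly k} := (c i j l)%:P * 'X^(w i + w j - w l).

(** A polynomial vanishing on the orbit becomes, along the curve [scaled_part], a polynomial in [s]
    with every [s != 0] as a root; so it vanishes at [s = 0] too. *)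
Lemma closure_graded_part :
  zariski_closure (orbit (struct_of c)) (struct_of graded_part).
Proof.
move=> C [I CI] orbC; apply/CI => p Ip; rewrite -scaled_part0.
pose b := vbasis {:structure 'rV[k]_n}.
pose Q r : {poly k} :=
  \sum_i \sum_j \sum_l coord b r (elem_struct k i j l) *: scaled_poly i j l.
have QE r s : (Q r).[s] = coord b r (struct_of (scaled_part s)).
  rewrite /Q /struct_of horner_sum linear_sum; apply: eq_bigr => i _.
  rewrite horner_sum linear_sum; apply: eq_bigr => j _.
  rewrite horner_sum linear_sum; apply: eq_bigr => l _.
  by rewrite linearZ /scaled_poly !hornerE /= /scaled_part; ring.
(* [P] is [p] with the coordinates [Q r] of the curve substituted for its variables. *)
pose P := \sum_(m <- mpoly.msupp p) mpoly.mcoeff m p *: \prod_r Q r ^+ mpoly.fun_of_multinom m r.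
have PE s : P.[s] = poly_fun p (struct_of (scaled_part s)).
  rewrite /P /poly_fun mpoly.mevalE horner_sum; apply: eq_bigr => m _.
  rewrite hornerZ horner_prod; congr (_ * _); apply: eq_bigr => r _.
  by rewrite horner_exp QE.
rewrite -PE (_ : P = 0) ?horner0 //; apply: (@poly_cofinite_roots _ _ [:: 0]) => s.
rewrite inE => s0; rewrite PE; apply: (CI _).1 Ip.
by apply: orbC; apply: scaled_part_orbit.
Qed.
End WeightLimit.

(** * Computation rules for the product *)

Section Bilinear.
Variables (k : fieldType) (A : algebra k).
Implicit Types (x y z : A) (a : k).
Local Notation "x ** y" := (mul A x y) (at level 40, left associativity).

Lemma amulDl x y z : (x + y) ** z = x ** z + y ** z.
Proof. by rewrite linearD add_lfunE. Qed.

Lemma amulDr x y z : x ** (y + z) = x ** y + x ** z.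
Proof. by rewrite linearD. Qed.

Lemma amulZl a x y : (a *: x) ** y = a *: (x ** y).
Proof. by rewrite linearZ scale_lfunE. Qed.

Lemma amulZr a x y : x ** (a *: y) = a *: (x ** y).
Proof. by rewrite linearZ. Qed.

Lemma amulNl x y : (- x) ** y = - (x ** y).
Proof. by rewrite linearN opp_lfunE. Qed.

Lemma amulNr x y : x ** (- y) = - (x ** y).
Proof. by rewrite linearN. Qed.

Lemma amulBl x y z : (x - y) ** z = x ** z - y ** z.
Proof. by rewrite amulDl amulNl. Qed.

Lemma amulBr x y z : x ** (y - z) = x ** y - x ** z.
Proof. by rewrite amulDr amulNr. Qed.

Lemma amul0l x : (0 : A) ** x = 0.
Proof. by rewrite linear0 zero_lfunE. Qed.

Lemma amul0r x : x ** (0 : A) = 0.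
Proof. by rewrite linear0. Qed.

Lemma amul_suml I (r : seq I) (P : pred I) (F : I -> A) x :
  (\sum_(i <- r | P i) F i) ** x = \sum_(i <- r | P i) F i ** x.
Proof. by rewrite linear_sum sum_lfunE. Qed.

Lemma amul_sumr I (r : seq I) (P : pred I) (F : I -> A) x :
  x ** (\sum_(i <- r | P i) F i) = \sum_(i <- r | P i) x ** F i.
Proof. by rewrite linear_sum. Qed.

Hypothesis hA : anticommutative A.

Lemma amulC x y : x ** y = - (y ** x).
Proof.
apply/eqP; rewrite -addr_eq0; have := hA (x + y).
by rewrite amulDl !amulDr !hA add0r addr0 => ->.
Qed.

End Bilinear.

Lemma isomorphic_refl (k : fieldType) (A : algebra k) : isomorphic A A.
Proof. by exists \1%VF => [|x y]; rewrite ?id_lfunE //; exists \1%VF => x; rewrite !id_lfunE. Qed.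


(** * Structure constants in a basis *)

Section Representation.
Variables (k : fieldType) (A : algebra k).
Local Notation n := (\dim {:A}).
Variables (X : n.-tuple A) (bX : basis_of {:A} X).
Variable c : 'I_n -> 'I_n -> 'I_n -> k.
Hypothesis Xc : forall i j : 'I_n, mul A X`_i X`_j = \sum_l c i j l *: X`_l.

Lemma isomorphic_struct : isomorphic A (Algebra (struct_of c)).
Proof.
pose f := linfun (rVof X) : 'Hom(A, Algebra (struct_of c)).
exists f => [|x y].
  by exists (vecof X) => x; rewrite lfunE /= ?rVofK ?vecofK.
rewrite !lfunE /= struct_ofE; apply: (can_inj (vecofK bX)).
rewrite rVofK // -{1}[x](rVofK bX) -{1}[y](rVofK bX) {1 2}/vecof.
rewrite amul_suml linear_sum /=; apply: eq_bigr => i _.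
rewrite amul_sumr linear_sum /=; apply: eq_bigr => j _.
rewrite amulZl amulZr Xc scalerA scaler_sumr [RHS]linear_sum; apply: eq_bigr => l _.
by rewrite [RHS]linearZ /= vecof_delta scalerA; congr (_ *: _); ring.
Qed.

End Representation.

Lemma degenerates_weight (k : closedFieldType) (A : algebra k) n
    (X : n.-tuple A) (w : nat -> nat) (c : 'I_n -> 'I_n -> 'I_n -> k) :
    basis_of {:A} X ->
    (forall i j : 'I_n, mul A X`_i X`_j = \sum_l c i j l *: X`_l) ->
    (forall i j l, c i j l != 0 -> (w l <= w i + w j)%N) ->
  degenerates A (Algebra (struct_of (graded_part w c))).
Proof.
move=> bX; have dA : \dim {:A} = n by apply: size_basis bX.
(* [degenerates] speaks of row vectors of length [\dim {:A}], so [n] is replaced by this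
   dimension. *)
case: _ / dA in X bX c * => Xc cw.
exists (struct_of c), (struct_of (graded_part w c)); split.
- exact: isomorphic_struct Xc.
- exact: isomorphic_refl.
- exact: closure_graded_part.
Qed.

(** * Anticommutative algebras given by tables *)

Section Tables.
Variables (k : fieldType) (n : nat) (tb : seq (nat * nat * nat)).

(** An entry (i, j, l) stands for y_i y_j = y_l and y_j y_i = - y_l; the antisymmetrised count is
    anticommutative for any list. *)
Definition table_coef (i j l : 'I_n) : k :=
  (count_mem (i : nat, j : nat, l : nat) tb)%:R
    - (count_mem (j : nat, i : nat, l : nat) tb)%:R.

Definition table_algebra : algebra k := Algebra (struct_of table_coef).

(** Indices are plain numbers, and those from [n] on give 0, so one table can be read in every
    dimension. *)
Definition std_vec (i : nat) : table_algebra := \row_(l < n) (l == i :> nat)%:R.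

Local Notation y := std_vec.

Lemma std_vec_delta (i : 'I_n) : y i = delta_mx 0 i.
Proof. by apply/rowP => l; rewrite !mxE. Qed.

Lemma std_vec_mul (i j : 'I_n) :
  mul table_algebra (y i) (y j) = \sum_l table_coef i j l *: y l.
Proof.
rewrite !std_vec_delta struct_of_delta.
by apply: eq_bigr => l _; rewrite std_vec_delta.
Qed.

Lemma std_vec_out i : (n <= i)%N -> y i = 0.
Proof.
move=> le_ni; apply/rowP => l; rewrite !mxE.
by case: eqP => // e; have := ltn_ord l; rewrite e ltnNge le_ni.
Qed.

(** Each coordinate of a square is a double sum of N i j - N j i against a symmetric expression;
    exchanging the sums cancels it without dividing by 2. *)
Lemma table_anticommutative : anticommutative table_algebra.
Proof.
move=> x; rewrite /= struct_ofE; apply/rowP => r; rewrite !summxE.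
pose N (i j : 'I_n) : k := (count_mem (i : nat, j : nat, r : nat) tb)%:R.
transitivity (\sum_i \sum_j (N i j - N j i) * (x 0 i * x 0 j)).
  apply: eq_bigr => i _; rewrite summxE; apply: eq_bigr => j _.
  rewrite summxE (bigD1 r) //= big1 => [|l nl].
    by rewrite !mxE !eqxx mulr1 addr0 mulrA.
  by rewrite !mxE eqxx eq_sym (negPf nl) mulr0.
rewrite mxE; under eq_bigr do under eq_bigr do rewrite mulrBl.
under eq_bigr do rewrite sumrB.
rewrite sumrB [X in _ - X]exchange_big /=; apply/eqP; rewrite subr_eq0; apply/eqP.
by apply: eq_bigr => i _; apply: eq_bigr => j _; congr (_ * _); rewrite mulrC.
Qed.

Lemma std_vec_mul_mem (W : {vspace table_algebra}) p q :
    (forall r, ((p, q, r) \in tb) || ((q, p, r) \in tb) -> y r \in W) ->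
  mul table_algebra (y p) (y q) \in W.
Proof.
move=> yW; have [lt_pn|/std_vec_out->] := ltnP p n; last by rewrite amul0l mem0v.
have [lt_qn|/std_vec_out->] := ltnP q n; last by rewrite amul0r mem0v.
rewrite (std_vec_mul (Ordinal lt_pn) (Ordinal lt_qn)); apply: memv_suml => l _.
have [in_tb|] := boolP (((p, q, l : nat) \in tb) || ((q, p, l : nat) \in tb)).
  by rewrite memvZ ?yW.
rewrite negb_or /table_coef => /andP[/count_memPn-> /count_memPn->].
by rewrite subrr scale0r mem0v.
Qed.

Lemma count_entry p q r l : uniq (unzip1 tb) -> (p, q, r) \in tb ->
  count_mem (p, q, l) tb = (l == r).
Proof.
move=> uk in_tb; have ut := map_uniq uk; rewrite count_uniq_mem //.
congr nat_of_bool; apply/idP/eqP => [in_tb'|->//].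
have [i lt_i ei] := nthP (0, 0, 0)%N in_tb.
have [j lt_j ej] := nthP (0, 0, 0)%N in_tb'.
suffices eij : i = j by move: ei; rewrite eij ej => -[].
have sz : size (unzip1 tb) = size tb by rewrite size_map.
apply/eqP; rewrite -(nth_uniq (0, 0)%N _ _ uk) ?sz //.
by rewrite !(nth_map (0, 0, 0)%N) // ei ej.
Qed.

Lemma count_nonentry p q l : (p, q) \notin unzip1 tb -> count_mem (p, q, l) tb = 0%N.
Proof. by move=> nk; apply/count_memPn; apply: contra nk => /(map_f fst). Qed.

Lemma std_vec_mul_entry p q r : uniq (unzip1 tb) -> (p, q, r) \in tb ->
    (q, p) \notin unzip1 tb -> (p < n)%N -> (q < n)%N -> 
  mul table_algebra (y p) (y q) = y r.
Proof.
move=> uk in_tb nk lt_pn lt_qn.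
rewrite (std_vec_mul (Ordinal lt_pn) (Ordinal lt_qn)).
under eq_bigr => l _.
  rewrite /table_coef /= (count_entry _ uk in_tb) (count_nonentry _ nk) subr0.
  over.
apply/rowP => l; rewrite summxE (bigD1 l) //= big1 => [|i ni].
  by rewrite !mxE eqxx mulr1 addr0.
have nli : (l == i :> nat) = false by apply/negbTE; rewrite eq_sym.
by rewrite !mxE nli mulr0.
Qed.

Lemma std_vec_free rs : uniq rs -> all (fun r => r < n)%N rs -> free (map y rs).
Proof.
move=> ur rn; apply/(@vector.freeP _ _ _ (map_tuple y (in_tuple rs))) => a a0 i.
have lt_i : (nth 0%N rs i < n)%N by apply/(allP rn)/mem_nth.
have /rowP/(_ (Ordinal lt_i)) := a0; rewrite summxE mxE (bigD1 i) //= big1.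
  by rewrite (nth_map 0%N) // !mxE eqxx mulr1 addr0.
move=> j nj; have nij : (i == j :> nat) = false by apply/negbTE; rewrite eq_sym.
by rewrite (nth_map 0%N) // !mxE /= nth_uniq // nij mulr0.
Qed.

Lemma std_vec_span : fullv = <<map y (iota 0 n)>>%VS :> {vspace table_algebra}.
Proof.
apply/eqP; rewrite eqEsubv subvf andbT; apply/subvP => x _.
have -> : x = \sum_(i < n) (x : 'rV[k]_n) 0 i *: y i.
  by rewrite [LHS]row_sum_delta; apply: eq_bigr => i _; rewrite std_vec_delta.
rewrite memv_suml // => i _; rewrite memvZ //.
by rewrite memv_span // map_f // mem_iota add0n ltn_ord.
Qed.

Lemma table_dim : \dim {: table_algebra} = n.
Proof. rewrite dimvf dim_matrix; exact: mul1n. Qed.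

End Tables.
Arguments table_algebra : simpl never.

(** * Powers of an algebra and their invariance under isomorphism *)

Section Powers.
Variables (k : fieldType) (A : algebra k).
Implicit Types (U V W : {vspace A}) (xs zs : seq A).

Lemma mul_space_span xs zs W :
    (forall x z, x \in xs -> z \in zs -> mul A x z \in W) ->
  (mul_space <<xs>> <<zs>> <= W)%VS.
Proof.
move=> xzW; apply/mul_spaceP => u v xu zv.
rewrite (@coord_span _ _ _ (in_tuple xs) _ xu) (@coord_span _ _ _ (in_tuple zs) _ zv).
rewrite amul_suml; apply: memv_suml => i _.
rewrite amul_sumr; apply: memv_suml => j _; rewrite amulZl amulZr !memvZ //.
by apply: xzW; apply: mem_nth.
Qed.

Lemma mem_mul_space U V u v : u \in U -> v \in V -> mul A u v \in mul_space U V.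
Proof. by apply/mul_spaceP: u v; apply: subvv. Qed.

Lemma powerSS i :
  power A i.+2 = (mul_space fullv (power A i.+1) + mul_space (power A i.+1) fullv)%VS.
Proof. by []. Qed.

Lemma mem_powerS i x u : u \in power A i.+1 -> mul A x u \in power A i.+2.
Proof.
move=> pu; rewrite powerSS (subvP (addvSl _ _)) // mem_mul_space //.
exact: memvf.
Qed.

Lemma powerSS_sub i W : anticommutative A ->
    (forall x u, u \in power A i.+1 -> mul A x u \in W) ->
  (power A i.+2 <= W)%VS.
Proof.
move=> hA puW; rewrite powerSS subv_add.
apply/andP; split; apply/mul_spaceP => u v pu pv; first exact: puW.
by rewrite amulC // memvN puW.
Qed.

Lemma powerSS_span i xs zs W : anticommutative A ->
    fullv = <<xs>>%VS -> (power A i.+1 <= <<zs>>)%VS ->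
    (forall x z, x \in xs -> z \in zs -> mul A x z \in W) ->
  (power A i.+2 <= W)%VS.
Proof.
move=> hA ex pz /mul_space_span; rewrite -ex => /mul_spaceP xzW.
by apply: powerSS_sub => // x u pu; apply: xzW; rewrite ?memvf // (subvP pz).
Qed.

End Powers.

Section Isomorphisms.
Variables (k : fieldType) (A B : algebra k).
Hypothesis AB : isomorphic A B.

Lemma isomorphic_dim_power i : (\dim (power A i) <= \dim (power B i))%N.
Proof.
have [f bf fM] := AB; have inj_f := bij_inj bf.
suffices fi : (f @: power A i <= power B i)%VS.
  rewrite -(limg_dim_eq (f := f)) ?dimvS //.
  by rewrite (eqP (_ : lker f == 0%VS)) ?capv0 //; apply/lker0P.
case: i => [|i]; first exact: subvf.
elim: i => [|i IH]; first exact: subvf.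
have fi u : u \in power A i.+1 -> f u \in power B i.+1.
  by move=> pu; apply/(subvP IH)/memv_img.
apply/subvP => _ /memv_imgP[u pu ->].
suffices /subvP/(_ u pu) : (power A i.+2 <= f @^-1: power B i.+2)%VS.
  by rewrite -memv_preim.
rewrite powerSS subv_add; apply/andP; split; apply/mul_spaceP => x y px py.
  rewrite -memv_preim fM powerSS (subvP (addvSl _ _)) // mem_mul_space ?memvf //.
  exact: fi.
rewrite -memv_preim fM powerSS (subvP (addvSr _ _)) // mem_mul_space ?memvf //.
exact: fi.
Qed.

Lemma isomorphic_nilpotent : nilpotent B -> nilpotent A.
Proof.
case=> m m0 pB0; exists m => //; apply/eqP.
by have := isomorphic_dim_power m; rewrite pB0 dimv0 leqn0 dimv_eq0.
Qed.

End Isomorphisms.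

(** * Squares and cubes of table algebras *)

Section TableInvariants.
Variables (k : fieldType) (n : nat) (tb : seq (nat * nat * nat)).
Local Notation T := (table_algebra k n tb).
Local Notation y := (@std_vec k n tb).

(** No factor pair and no result occurs twice, and no left factor is itself a result. Thus the
    results form a basis of the square, and the cube only sees entries whose right factor is a
    result. *)
Definition table_wf := [&& uniq (unzip1 tb), uniq (unzip2 tb) &
  all (fun t => [&& t.1.1 < t.1.2, t.1.2 < n, t.2 < n & t.1.1 \notin unzip2 tb])%N tb].

Hypothesis wf : table_wf.

Lemma table_entry p q r : (p, q, r) \in tb -> mul T (y p) (y q) = y r.
Proof.
case/and3P: wf => uk _ /allP ok in_tb; have /and4P[/= pq qn rn _] := ok _ in_tb.
apply: std_vec_mul_entry => //; last exact: ltn_trans qn.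
by apply/mapP => -[[[p' q'] r'] /ok/and4P[/= qp _ _ _] [e1 e2]]; lia.
Qed.

Lemma mem_power_entry p q r i : (p, q, r) \in tb ->
  y q \in power T i.+1 -> y r \in power T i.+2.
Proof. by move/table_entry <-; apply: mem_powerS. Qed.

Lemma table_power2 : (power T 2%N <= <<map y (unzip2 tb)>>)%VS.
Proof.
apply: (powerSS_span (i := 0%N) (zs := map y (iota 0 n))
  (@table_anticommutative k n tb) (std_vec_span k n tb)).
  by rewrite -std_vec_span subvv.
move=> _ _ /mapP[p _ ->] /mapP[q _ ->]; apply: std_vec_mul_mem => r in_tb.
by apply/memv_span/map_f; case/orP: in_tb => /(map_f snd).
Qed.

Lemma table_dim_power2 : \dim (power T 2%N) = size tb.
Proof.
case/and3P: (wf) => _ ur /allP ok.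
have fr : free (map y (unzip2 tb)).
  by apply: std_vec_free => //; apply/allP => _ /mapP[t /ok/and4P[_ _ rn _] ->].
rewrite -(size_map snd tb) -(size_map y) -(eqP fr); congr (\dim _); apply/eqP.
rewrite eqEsubv table_power2 /=; apply/span_subvP => _ /mapP[_ /mapP[[[p q] r] in_tb ->] ->] /=.
exact: (mem_power_entry (i := 0%N) in_tb (memvf _)).
Qed.

Definition table_step2 := [seq t <- tb | t.1.2 \in unzip2 tb].

Lemma table_dim_power3 : \dim (power T 3%N) = size table_step2.
Proof.
case/and3P: (wf) => _ ur /allP ok.
have fr : free (map y (unzip2 table_step2)).
  apply: std_vec_free; last first.
    by apply/allP => r /mapP[t]; rewrite mem_filter => /andP[_ /ok/and4P[_ _ rn _]] ->.
  by apply: subseq_uniq ur; apply/map_subseq/filter_subseq.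
rewrite -(size_map snd) -(size_map y) -(eqP fr); congr (\dim _); apply/eqP.
rewrite eqEsubv; apply/andP; split.
  apply: (powerSS_span (@table_anticommutative k n tb) (std_vec_span k n tb) table_power2).
  move=> _ _ /mapP[p _ ->] /mapP[q q2 ->]; apply: std_vec_mul_mem => r in_tb.
  apply/memv_span/map_f/mapP; case/orP: in_tb => in_tb.
    by exists (p, q, r); rewrite // mem_filter q2.
  (* In the reversed entry the element [q] of the square would be a left factor, which [table_wf]
     excludes. *)
  by have /and4P[_ _ _] := ok _ in_tb; rewrite q2.
apply/span_subvP => _ /mapP[_ /mapP[[[p q] r] + ->] ->] /=.
rewrite mem_filter => /andP[/= /mapP[[[p' q'] q''] in_tb' /= ->] in_tb].
exact: (mem_power_entry in_tb (mem_power_entry (i := 0%N) in_tb' (memvf _))).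
Qed.

End TableInvariants.

(** [w] is a grading with positive weights at most [W], so the power of index [i.+1] lives in
    weights above [i]. *)
Lemma table_nilpotent (k : fieldType) n tb (w : nat -> nat) W :
    (forall i, 0 < w i <= W)%N ->
    all (fun t => (t.2 < n) && (w t.2 == w t.1.1 + w t.1.2))%N tb ->
  nilpotent (table_algebra k n tb).
Proof.
move=> wW /allP hom; exists W.+1 => //; apply/eqP; rewrite -subv0.
pose y := @std_vec k n tb.
have pi i : (power (table_algebra k n tb) i.+1 <= <<map y [seq r <- iota 0 n | i < w r]%N>>)%VS.
  elim: i => [|i IH].
    rewrite (_ : [seq r <- _ | _] = iota 0 n) -?std_vec_span ?subvf //.
    by apply/all_filterP/allP => r _; case/andP: (wW r).
  apply: (powerSS_span (@table_anticommutative k n tb) (std_vec_span k n tb) IH).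
  move=> _ _ /mapP[p _ ->] /mapP[q q2 ->]; apply: std_vec_mul_mem => r in_tb.
  apply/memv_span/map_f; rewrite mem_filter mem_iota /= add0n.
  have wp := wW p; move: q2; rewrite mem_filter => /andP[iq _].
  by case/orP: in_tb => /hom/andP[/= -> /eqP e]; rewrite andbT; lia.
apply: subv_trans (pi W) _; rewrite (_ : [seq r <- _ | _] = [::]) ?span_nil ?subvv //.
apply/eqP; rewrite -size_eq0 size_filter -leqn0 leqNgt -has_count.
by apply/hasPn => r _; have := wW r; lia.
Qed.

Lemma basis_extension (k : fieldType) (V : vectType k) (h : seq V) : free h ->
  exists2 X : (\dim {:V}).-tuple V, basis_of {:V} X &
    forall i, (i < size h)%N -> X`_i = h`_i.
Proof.
move=> fh; pose X := h ++ vbasis (<<h>>^C)%VS.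
have bX : basis_of {:V} X.
  rewrite -(addv_complf <<h>>%VS); apply: cat_basis; last exact: vbasisP.
    by apply/directv_addP/capv_compl.
  by rewrite basisEfree fh subvv -(eqP fh) leqnn.
have sX : size X == \dim {:V} by rewrite -(size_basis (X := in_tuple X) bX).
by exists (Tuple sX) => // i lt_i; rewrite /= nth_cat lt_i.
Qed.

(** * Degeneration of an algebra to a table *)

Section DegenerationToTable.
Variables (k : closedFieldType) (A : algebra k).
Hypothesis hA : anticommutative A.

(** Coordinates of a product of smaller weight than the product tend to 0. Those of equal weight
    must agree with the table, and those of larger weight must vanish, the table being
    homogeneous. *)
Lemma degenerates_table n (X : n.-tuple A) (w : nat -> nat) tb :
    basis_of {:A} X ->
    (forall p q r, (p, q, r) \in tb -> (p < q)%N /\ w r = (w p + w q)%N) ->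
    (forall i j l : 'I_n, (i < j)%N -> (w i + w j <= w l)%N ->
      coord X l (mul A X`_i X`_j) = (count_mem (i : nat, j : nat, l : nat) tb)%:R) ->
  degenerates A (table_algebra k n tb).
Proof.
move=> bX tbw Xtb; pose c (i j l : 'I_n) : k := coord X l (mul A X`_i X`_j).
have cnt0 (p q r : nat) : (w r != w p + w q)%N || (q <= p)%N ->
    count_mem (p, q, r) tb = 0%N.
  by move=> ne; apply/count_memPn; apply: contraTN ne => /tbw[lt ->]; rewrite eqxx -ltnNge.
have cE (i j l : 'I_n) : (w i + w j <= w l)%N -> c i j l = table_coef k tb i j l.
  rewrite /c /table_coef; case: (ltngtP i j) => [lt|gt|eij] le.
  - by rewrite Xtb // [X in _ - X%:R]cnt0 ?subr0 // orbC ltnW.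
  - rewrite amulC // linearN /= Xtb // 1?addnC //.
    by rewrite [X in X%:R - _]cnt0 ?sub0r // orbC ltnW.
  - by rewrite -(val_inj eij) hA linear0 subrr.
have -> : table_algebra k n tb = Algebra (struct_of (graded_part w c)).
  congr Algebra; apply: eq_bigr => i _; apply: eq_bigr => j _.
  apply: eq_bigr => l _; congr (_ *: _); rewrite /graded_part.
  case: eqP => [e|/eqP ne]; first by rewrite cE // e.
  by rewrite /table_coef !cnt0 ?subrr // ?ne // addnC ne.
apply: (degenerates_weight bX) => [i j|i j l].
  by rewrite [LHS](coord_basis bX) ?memvf.
apply: contraR; rewrite -ltnNge => lt; rewrite cE ?(ltnW lt) //.
rewrite /table_coef !cnt0 ?subrr //; first by rewrite addnC gtn_eqF.
by rewrite gtn_eqF.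
Qed.

(* The conditions on [w] hold when the element of index 0 has weight 1, the
   other listed elements form chains under it whose weights increase by one up
   to [W], and everything else has weight [W]; as [W < 4 + 4] no product
   without the element of index 0 survives in the limit. *)
Lemma degenerates_chains (h : seq A) (tb : seq (nat * nat * nat))
    (w : nat -> nat) W n :
    \dim {:A} = n -> free h -> uniq (unzip1 tb) ->
    (forall p q r, (p, q, r) \in tb ->
      [/\ p = 0, 0 < q, q < size h, r < size h & w r = (w q).+1]%N) ->
    (forall p q r, (p, q, r) \in tb -> mul A h`_p h`_q = h`_r) ->
    (W < 8)%N -> w 0%N = 1%N -> (forall j, 0 < j -> 4 <= w j <= W)%N ->
    (forall j, 0 < j -> (0, j)%N \notin unzip1 tb -> w j = W)%N ->
  degenerates A (table_algebra k n tb).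
Proof.
move=> <- fh uk tbh htb W8 w0 wW wend.
have [X bX Xh] := basis_extension fh.
apply: (degenerates_table (w := w) bX) => [p q r in_tb|i j l lt le].
  by have [-> ? ? ? ->] := tbh _ _ _ in_tb; rewrite w0; lia.
have wl : (w l <= W)%N.
  by have [->|l0] := posnP l; [have := wW 1%N isT; lia | have := wW l l0; lia].
have [i0|i0] := posnP i; last by have := wW i i0; have := wW j (ltn_trans i0 lt); lia.
have [/mapP[[[p q] r] in_tb /= [e1 e2]]|nk] := boolP ((i : nat, j : nat) \in unzip1 tb).
  have [p0 q0 qh rh wr] := tbh _ _ _ in_tb.
  have h0 : (0 < size h)%N by apply: leq_ltn_trans qh.
  rewrite e1 e2 (count_entry _ uk in_tb) p0 !Xh // -{1}p0 (htb _ _ _ in_tb).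
  have dr : (r < \dim {:A})%N.
    by apply: leq_trans rh _; rewrite -(eqP fh) dimvS ?subvf.
  rewrite -(Xh r) // (coord_free (Ordinal dr)); last exact: basis_free bX.
  by congr (nat_of_bool _)%:R; rewrite -val_eqE eq_sym.
by have := wend j; rewrite -i0 => /(_ _ nk); rewrite i0 in lt le; lia.
Qed.

End DegenerationToTable.

Lemma free_shear (k : fieldType) (V : vectType k) (s1 s2 : seq V) x z :
  z \in <<s1>>%VS -> free (s1 ++ x :: s2) -> free (s1 ++ (x + z) :: s2).
Proof.
have pm t : perm_eq (s1 ++ t :: s2) (t :: s1 ++ s2) by rewrite (perm_catCA s1 [:: t] s2).
move=> zs; rewrite !(perm_free (pm _)) !free_cons => /andP[nx ->]; rewrite andbT.
apply: contra nx => xz; rewrite -(addrK z x) memvB //.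
by rewrite span_cat (subvP (addvSl _ _)).
Qed.

(** Boolean form of the conditions of [degenerates_chains], so that concrete tables are checked by
    computation; [W] is also the weight of indices beyond [ws]. *)
Definition chain_table (tb : seq (nat * nat * nat)) (ws : seq nat) W m :=
  let w := nth W ws in
  [&& uniq (unzip1 tb),
      all (fun t => [&& t.1.1 == 0, 0 < t.1.2 < m, t.2 < m &
                        w t.2 == (w t.1.2).+1])%N tb,
      (3 < W < 8)%N, w 0 == 1%N, all (fun v => 4 <= v <= W)%N (behead ws) &
      all (fun j => ((0, j)%N \in unzip1 tb) || (w j == W)) (iota 1 (size ws))].

Lemma chain_table_degenerates (k : closedFieldType) (A : algebra k) n
    (h : seq A) tb ws W :
    anticommutative A -> \dim {:A} = n -> chain_table tb ws W (size h) -> free h ->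
    all (fun t => mul A h`_t.1.1 h`_t.1.2 == h`_t.2) tb ->
  degenerates A (table_algebra k n tb).
Proof.
move=> hA dA /and5P[uk /allP tbh /andP[W3 W8] /eqP w0 /andP[/allP wsW /allP wend]] fh htb.
apply: (@degenerates_chains _ _ hA h tb (nth W ws) W n) => // [p q r|p q r|j j0|j j0 nk].
- by move=> /tbh/and4P[/= /eqP p0 /andP[q0 qh] rh /eqP wr].
- by move=> /(allP htb)/= /eqP.
- have [lt_j|le_j] := ltnP j (size ws); last by rewrite nth_default // W3 leqnn.
  case: ws lt_j wsW {tbh w0 wend} => //= v ws lt_j; apply.
  by case: j j0 lt_j => //= j _ lt_j; apply: mem_nth.
have [lt_j|le_j] := ltnP j (size ws); last by rewrite nth_default.
by have := wend j; rewrite mem_iota (negPf nk) j0 add1n ltnS ltnW //= => /(_ isT)/eqP.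
Qed.

(** * Chains of degenerations between tables *)

Section TableChains.
Variable k : closedFieldType.
Local Notation T := (table_algebra k).

Lemma table_wf_widen m n tb : (m <= n)%N -> table_wf m tb -> table_wf n tb.
Proof.
move=> le_mn /and3P[uk ur /allP ok]; apply/and3P; split=> //; apply/allP => t /ok.
by case/and4P => pq qm rm nr; rewrite pq nr !(leq_trans _ le_mn).
Qed.

Lemma std_vec_mul0 n tb p q :
    (p, q) \notin unzip1 tb -> (q, p) \notin unzip1 tb ->
  mul (T n tb) (std_vec k n tb p) (std_vec k n tb q) = 0.
Proof.
move=> pq qp; apply/eqP; rewrite -memv0; apply: std_vec_mul_mem => r.
by case/orP => /(map_f fst); [rewrite (negPf pq) | rewrite (negPf qp)].
Qed.

(** The sizes compared are the dimensions of squares and cubes, which isomorphisms preserve. *)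
Definition finer_table (tb tb' : seq (nat * nat * nat)) :=
  (size tb' < size tb)%N || (size (table_step2 tb') < size (table_step2 tb))%N.

Lemma finer_table_not_isomorphic n tb tb' :
    table_wf n tb -> table_wf n tb' -> finer_table tb tb' ->
  ~ isomorphic (T n tb) (T n tb').
Proof.
move=> wf wf' fin iso.
have le_eq a b c d : (a <= b)%N -> a = c -> b = d -> (c <= d)%N by move=> + <- <-.
have le2 := le_eq _ _ _ _ (isomorphic_dim_power iso 2%N)
  (table_dim_power2 k wf) (table_dim_power2 k wf').
have le3 := le_eq _ _ _ _ (isomorphic_dim_power iso 3%N)
  (table_dim_power3 k wf) (table_dim_power3 k wf').
by case/orP: fin; rewrite ltnNge ?le2 ?le3.
Qed.

(** Well-formedness is asked in a concrete dimension [m], where it is decided by computation, and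
    then widened to [n]. *)
Lemma table_chain_step m n tb tb' (h : seq (T n tb)) ws W i :
    (m <= n)%N -> table_wf m tb -> table_wf m tb' -> finer_table tb tb' ->
    chain_table tb' ws W (size h) -> free h ->
    all (fun t => mul _ h`_t.1.1 h`_t.1.2 == h`_t.2) tb' ->
    degeneration_chain i (T n tb') ->
  degeneration_chain i.+1 (T n tb).
Proof.
move=> mn wf wf' fin ct fh htb ch; exists (T n tb'); split=> //.
  apply: chain_table_degenerates ct fh htb => //; first exact: table_anticommutative.
  exact: table_dim.
by apply: finer_table_not_isomorphic fin; apply: table_wf_widen mn _.
Qed.

(* The element of index 0 acts nilpotently; the digits in a name are the sizes
   of the nontrivial Jordan blocks. *)
Definition tbl4 := [:: (0, 1, 2); (0, 2, 3); (0, 3, 4)]%N.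
Definition tbl33 := [:: (0, 1, 2); (0, 2, 3); (0, 4, 5); (0, 5, 6)]%N.
Definition tbl32 := [:: (0, 1, 2); (0, 2, 3); (0, 4, 5)]%N.
Definition tbl3 := [:: (0, 1, 2); (0, 2, 3)]%N.
Definition tbl22 := [:: (0, 1, 2); (0, 3, 4)]%N.
Definition tbl2 := [:: (0, 1, 2)]%N.

Lemma chain_tbl2 n : (3 <= n)%N -> degeneration_chain 1 (T n tbl2).
Proof.
move=> n3; apply: (@table_chain_step 3 n tbl2 [::]
  [::] [:: 1] 4 0 n3) => //.
exact: nil_free.
Qed.

Lemma chain_tbl22 n : (5 <= n)%N -> degeneration_chain 2 (T n tbl22).
Proof.
move=> n5; pose y := std_vec k n tbl22.
have wf : table_wf n tbl22 by apply: table_wf_widen n5 _.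
apply: (@table_chain_step 5 n tbl22 tbl2
  (map y [:: 0; 1; 2]%N) [:: 1; 4; 5] 5 1 n5) => //.
- by apply: std_vec_free => //=; rewrite !(leq_trans _ n5).
- by rewrite all_seq1; apply/eqP/(table_entry k wf).
by apply: chain_tbl2; apply: leq_trans n5.
Qed.

(** As y_0 kills y_4, it maps [y 4 + y 2] to [y 3]. This gives a second block of size 2 beside y_1,
    y_2, and the spare vector y_4 keeps the family free. *)
Lemma chain_tbl3 n : (5 <= n)%N -> degeneration_chain 3 (T n tbl3).
Proof.
move=> n5; pose y := std_vec k n tbl3.
have wf : table_wf n tbl3 by apply: table_wf_widen n5 _.
apply: (@table_chain_step 5 n tbl3 tbl22
  [:: y 0%N; y 1%N; y 2%N; y 4%N + y 2%N; y 3%N] [:: 1; 4; 5; 4; 5] 5 2 n5) => //.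
- apply: (@free_shear _ _ [:: y 0; y 1; y 2]%N [:: y 3%N]).
    by rewrite memv_span // !inE eqxx !orbT.
  apply: (@std_vec_free k n tbl3 [:: 0; 1; 2; 4; 3]%N) => //=.
  by rewrite !(leq_trans _ n5).
- apply/allP => t; rewrite !inE => /orP[] /eqP->; apply/eqP.
    exact: (table_entry k wf).
  rewrite [LHS](amulDr (A := T n tbl3)) (@std_vec_mul0 n tbl3 0 4) // add0r.
  exact: (table_entry k wf).
exact: chain_tbl22.
Qed.

Lemma chain_tbl32 n : (6 <= n)%N -> degeneration_chain 4 (T n tbl32).
Proof.
move=> n6; pose y := std_vec k n tbl32.
have wf : table_wf n tbl32 by apply: table_wf_widen n6 _.
apply: (@table_chain_step 6 n tbl32 tbl3
  (map y [:: 0; 1; 2; 3]%N) [:: 1; 4; 5; 6] 6 3 n6) => //.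
- by apply: std_vec_free => //=; rewrite !(leq_trans _ n6).
- apply/allP => t; rewrite !inE => /orP[] /eqP->; apply/eqP;
    exact: (table_entry k wf).
by apply: chain_tbl3; apply: leq_trans n6.
Qed.

Lemma chain_tbl33 n : (7 <= n)%N -> degeneration_chain 5 (T n tbl33).
Proof.
move=> n7; pose y := std_vec k n tbl33.
have wf : table_wf n tbl33 by apply: table_wf_widen n7 _.
apply: (@table_chain_step 7 n tbl33 tbl32
  (map y [:: 0; 1; 2; 3; 4; 5]%N) [:: 1; 4; 5; 6; 5; 6] 6 4 n7) => //.
- by apply: std_vec_free => //=; rewrite !(leq_trans _ n7).
- apply/allP => t; rewrite !inE => /or3P[] /eqP->; apply/eqP;
    exact: (table_entry k wf).
by apply: chain_tbl32; apply: leq_trans n7.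
Qed.

(** The same device: the spare vector y_5 makes [y 5 + y 3], which y_0 maps to [y 4], independent of
    the block y_1, y_2, y_3. *)
Lemma chain_tbl4 n : (6 <= n)%N -> degeneration_chain 5 (T n tbl4).
Proof.
move=> n6; pose y := std_vec k n tbl4.
have wf : table_wf n tbl4 by apply: table_wf_widen n6 _.
apply: (@table_chain_step 6 n tbl4 tbl32
  [:: y 0%N; y 1%N; y 2%N; y 3%N; y 5%N + y 3%N; y 4%N] [:: 1; 4; 5; 6; 5; 6] 6 4 n6) => //.
- apply: (@free_shear _ _ [:: y 0; y 1; y 2; y 3]%N [:: y 4%N]).
    by rewrite memv_span // !inE eqxx !orbT.
  apply: (@std_vec_free k n tbl4 [:: 0; 1; 2; 3; 5; 4]%N) => //=.
  by rewrite !(leq_trans _ n6).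
- apply/allP => t; rewrite !inE => /or3P[] /eqP->; apply/eqP.
  - exact: (table_entry k wf).
  - exact: (table_entry k wf).
  rewrite [LHS](amulDr (A := T n tbl4)) (@std_vec_mul0 n tbl4 0 5) // add0r.
  exact: (table_entry k wf).
exact: chain_tbl32.
Qed.

(** In dimension 5 there is no spare vector to reach [tbl32], so the chain goes directly to [tbl3]
    and is one step shorter. *)
Lemma chain_tbl4_dim5 n : (5 <= n)%N -> degeneration_chain 4 (T n tbl4).
Proof.
move=> n5; pose y := std_vec k n tbl4.
have wf : table_wf n tbl4 by apply: table_wf_widen n5 _.
apply: (@table_chain_step 5 n tbl4 tbl3
  (map y [:: 0; 1; 2; 3]%N) [:: 1; 4; 5; 6] 6 3 n5) => //.
- by apply: std_vec_free => //=; rewrite !(leq_trans _ n5).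
- apply/allP => t; rewrite !inE => /orP[] /eqP->; apply/eqP;
    exact: (table_entry k wf).
exact: chain_tbl3.
Qed.

End TableChains.

Lemma freeI (k : fieldType) (V : vectType k) (s : seq V) :
    (forall ks : seq k, size ks = size s ->
      \sum_(p <- zip ks s) p.1 *: p.2 = 0 -> all (pred1 0) ks) ->
  free s.
Proof.
move=> h; apply/(@vector.freeP _ _ _ (in_tuple s)) => c c0 i.
pose ks := [seq c j | j <- enum 'I_(size s)].
have sks : size ks = size s by rewrite size_map size_enum_ord.
have ksi (j : 'I_(size s)) : ks`_j = c j by rewrite (nth_map j) ?size_enum_ord // nth_ord_enum.
have := h ks sks; rewrite (big_nth (0, 0)) size_zip sks minnn big_mkord.
under eq_bigr do rewrite nth_zip //= ksi.
by move=> /(_ c0)/allP/(_ (c i)) h0; apply/eqP/h0/map_f; rewrite mem_enum.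
Qed.

Lemma free2P (k : fieldType) (V : vectType k) (u v : V) p q :
  free [:: u; v] -> p *: u + q *: v = 0 -> p = 0 /\ q = 0.
Proof.
move=> fr rel; have /(@vector.freeP _ _ _ (in_tuple _)) g := fr.
have := g (fun i => [:: p; q]`_i); rewrite !big_ord_recl big_ord0 /= addr0.
by move=> /(_ rel) k0; split; [have := k0 ord0 | have := k0 ord_max].
Qed.

Lemma coord_span_eq0 (k : fieldType) (V : vectType k) n (X : n.-tuple V) i s u :
  {in s, forall x, coord X i x = 0} -> u \in <<s>>%VS -> coord X i u = 0.
Proof.
move=> s0 us; rewrite (@coord_span _ _ _ (in_tuple s) _ us) linear_sum big1 // => j _.
by rewrite linearZ /= s0 ?mulr0 // mem_nth.
Qed.

(** * Linear independence from the Engel condition *)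

Section EngelFree.
Variables (k : fieldType) (A : algebra k).
Hypotheses (hA : anticommutative A) (eA : engel A).
Local Notation "x ** y" := (mul A x y) (at level 40, left associativity).

Lemma engel_eigen (a b : A) s : a ** b = s *: b -> s = 0 \/ b = 0.
Proof.
move=> ab; have [m _ /(_ a b)] := eA.
have -> : iter m (left_mul a) b = s ^+ m *: b.
  elim: m => [|m IH]; first by rewrite scale1r.
  by rewrite iterS IH /left_mul amulZr ab scalerA -exprSr.
move=> /eqP; rewrite scaler_eq0 expf_eq0 => /orP[/andP[_ /eqP->]|/eqP->]; by [left|right].
Qed.

(** By anticommutativity [a] is an eigenvector of the nilpotent operator L_b. *)
Lemma engel_notin_image (a b : A) s : a ** b = s *: a -> s = 0 \/ a = 0.
Proof.
move=> ab; have /engel_eigen[/eqP|] : b ** a = (- s) *: a; last by right.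
  by rewrite amulC // ab scaleNr.
by rewrite oppr_eq0 => /eqP; left.
Qed.

(** Applying L_a^3, L_a^2 and L_a to a linear relation kills in turn the coefficients of [b], [c]
    and [d]. *)
Lemma engel_free_chain (a b : A) :
    a ** (a ** (a ** b)) != 0 -> a ** (a ** (a ** (a ** b))) = 0 ->
  free [:: a; b; a ** b; a ** (a ** b); a ** (a ** (a ** b))].
Proof.
set c := a ** b; set d := a ** c; set e := a ** d => e0 ae.
have E := (amulDr, amulZr, hA a, erefl _ : a ** b = c, erefl _ : a ** c = d,
  erefl _ : a ** d = e, ae, amul0r, scaler0, add0r, addr0, scale0r).
have a0 : a != 0 by apply: contraNneq e0 => a0; rewrite /e a0 amul0l.
apply: freeI => -[|k0 [|k1 [|k2 [|k3 [|k4 [|//]]]]]] //= _.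
rewrite !big_cons big_nil /= addr0 => rel.
have := congr1 (mul A a \o mul A a \o mul A a) rel; rewrite /= !E => /eqP.
rewrite scaler_eq0 (negPf e0) orbF => /eqP k10; rewrite k10 !E in rel *.
have := congr1 (mul A a \o mul A a) rel; rewrite /= !E => /eqP.
rewrite scaler_eq0 (negPf e0) orbF => /eqP k20; rewrite k20 !E in rel *.
have := congr1 (mul A a) rel; rewrite /= !E => /eqP.
rewrite scaler_eq0 (negPf e0) orbF => /eqP k30; rewrite k30 !E in rel *.
(* What is left is k0 a + k4 e = 0, which puts k0 a into the image of L_a because e = a d. *)
have /engel_notin_image[/eqP|/eqP] : a ** (k4 *: d) = - k0 *: a.
- by rewrite !E scaleNr; apply/eqP; rewrite -addr_eq0 addrC; apply/eqP.
- rewrite oppr_eq0 => /eqP k00; move: rel; rewrite k00 !E => /eqP.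
  by rewrite scaler_eq0 (negPf e0) orbF => /eqP->; rewrite !eqxx.
- by rewrite (negPf a0).
Qed.

Lemma engel_free_chains (a u v : A) :
    (forall x, a ** (a ** (a ** x)) = 0) ->
    free [:: a ** (a ** u); a ** (a ** v)] ->
  free [:: a; u; a ** u; a ** (a ** u); v; a ** v; a ** (a ** v)].
Proof.
set u1 := a ** u; set u2 := a ** u1; set v1 := a ** v; set v2 := a ** v1 => a3 fr.
have E := (amulDr, amulZr, hA a, erefl _ : a ** u = u1, erefl _ : a ** u1 = u2,
  erefl _ : a ** v = v1, erefl _ : a ** v1 = v2, a3 u : a ** u2 = 0,
  a3 v : a ** v2 = 0, amul0r, scaler0, add0r, addr0, scale0r).
have a0 : a != 0.
  apply: contraTneq fr => a0; rewrite /u2 a0 amul0l free_cons negb_and negbK.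
  by rewrite mem0v.
apply: freeI => -[|k0 [|k1 [|k2 [|k3 [|l1 [|l2 [|l3 [|//]]]]]]]] //= _.
rewrite !big_cons big_nil /= addr0 => rel.
have := congr1 (mul A a \o mul A a) rel; rewrite /= !E => /(free2P fr)[k10 l10].
rewrite k10 l10 !E in rel *.
have := congr1 (mul A a) rel; rewrite /= !E => /(free2P fr)[k20 l20].
rewrite k20 l20 !E in rel *.
have /engel_notin_image[/eqP|/eqP] : a ** (k3 *: u1 + l3 *: v1) = - k0 *: a.
- by rewrite !E scaleNr; apply/eqP; rewrite -addr_eq0 addrC; apply/eqP.
- rewrite oppr_eq0 => /eqP k00; move: rel; rewrite k00 !E => /(free2P fr)[-> ->].
  by rewrite !eqxx.
- by rewrite (negPf a0).
Qed.

End EngelFree.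

(** * Six-step chains starting at a non-nilpotent algebra *)

Section LongChains.
Variable k : closedFieldType.
Local Notation T := (table_algebra k).

Lemma chain_table_nilpotent n tb ws W m :
  (m <= n)%N -> chain_table tb ws W m -> nilpotent (T n tb).
Proof.
move=> mn /and5P[_ /allP tbh /andP[W3 W8] /eqP w0 /andP[/allP wsW _]].
apply: (@table_nilpotent _ _ _ (nth W ws) W) => [i|].
  have [lt_i|le_i] := ltnP i (size ws); last by rewrite nth_default; lia.
  case: ws lt_i wsW w0 {tbh} => //= v ws lt_i wsW /= w0.
  case: i lt_i => [_|i lt_i] /=; first by lia.
  by case/andP: (wsW _ (mem_nth W lt_i)) => lt3 ->; rewrite andbT (leq_trans _ lt3).
by apply/allP => t /tbh/and4P[/eqP-> q0 rm /eqP->]; rewrite w0 add1n eqxx (leq_trans rm).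
Qed.

(** The first step is non-trivial because the table algebra is nilpotent and [A] is not. *)
Lemma chain_table_long_chain (A : algebra k) n (h : seq A) tb ws W i :
    anticommutative A -> ~ nilpotent A -> \dim {:A} = n ->
    chain_table tb ws W (size h) -> free h ->
    all (fun t => mul A h`_t.1.1 h`_t.1.2 == h`_t.2) tb ->
    degeneration_chain i (T n tb) ->
  degeneration_chain i.+1 A.
Proof.
move=> hA nA dA ct fh htb ch; exists (T n tb); split=> //.
  exact: chain_table_degenerates ct fh htb.
move=> /isomorphic_nilpotent iso; apply/nA/iso.
by apply: chain_table_nilpotent ct; rewrite -dA -(eqP fh) dimvS ?subvf.
Qed.

Lemma long_chain_dim6 (A : algebra k) (a b : A) :
    anticommutative A -> ~ nilpotent A -> (6 <= \dim {:A})%N ->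
    free [:: a; b; mul A a b; mul A a (mul A a b); mul A a (mul A a (mul A a b))] ->
  degeneration_chain 6 A.
Proof.
move=> hA nA dA fh.
apply: (chain_table_long_chain hA nA (erefl _)
  (_ : chain_table tbl4 [:: 1; 4; 5; 6; 7] 7 _) fh) => //.
  by rewrite /= !eqxx.
exact: chain_tbl4.
Qed.

Lemma long_chain_two_blocks (A : algebra k) (a u v : A) :
    anticommutative A -> ~ nilpotent A ->
    free [:: a; u; mul A a u; mul A a (mul A a u);
             v; mul A a v; mul A a (mul A a v)] ->
  degeneration_chain 6 A.
Proof.
move=> hA nA fh.
apply: (chain_table_long_chain hA nA (erefl _)
  (_ : chain_table tbl33 [:: 1; 4; 5; 6; 4; 5; 6] 6 _) fh) => //.
  by rewrite /= !eqxx.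
by apply: chain_tbl33; have /= <- := eqP fh; rewrite dimvS ?subvf.
Qed.

(* Strictly between [A] and [tbl4] when A has dimension 5. *)
Definition tblM := rcons tbl4 (1, 2, 4)%N.
Local Notation M := (T 5 tblM).

Lemma M_nilpotent : nilpotent M.
Proof.
apply: (@table_nilpotent _ _ _ (nth 5 [:: 1; 2; 3; 4; 5]) 5) => [i|//].
by case: i => [|[|[|[|[|i]]]]] //=; rewrite nth_nil.
Qed.

(** The powers of [M] and of [tbl4] have equal dimensions, so another invariant is used: in [tbl4]
    all left multiplications move a given product into one line, while in [M] y_0 y_2 and y_1 y_2
    are independent. *)
Lemma isomorphic_parallel (A B : algebra k) (z : B) :
    isomorphic A B ->
    (forall x u, u \in power B 2%N -> exists s, mul B x u = s *: mul B z u) ->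
  forall x x' p q : A,
    ~~ free [:: mul A x (mul A p q); mul A x' (mul A p q)].
Proof.
case=> f bf fM par x x' p q; have inj_f := bij_inj bf.
have pu : f (mul A p q) \in power B 2%N.
  by rewrite fM; apply: (@mem_powerS _ _ 0%N); apply: memvf.
set u := mul A p q in pu *.
have [s es] := par (f x) _ pu; have [s' es'] := par (f x') _ pu.
apply/negP; rewrite free_cons seq1_free span_seq1 => /andP[/vlineP nv v'0].
have s'0 : s' != 0.
  apply: contraNneq v'0 => s'0; apply/eqP/inj_f.
  by rewrite fM es' s'0 scale0r linear0.
case: nv; exists (s / s'); apply: inj_f.
by rewrite linearZ /= (fM x) (fM x') es es' scalerA divfK.
Qed.

Lemma tbl4_parallel (x u : T 5 tbl4) : u \in power (T 5 tbl4) 2%N ->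
  exists s, mul (T 5 tbl4) x u = s *: mul (T 5 tbl4) (std_vec k 5 tbl4 0) u.
Proof.
pose z := std_vec k 5 tbl4; move=> p2.
have p2' := subvP (table_power2 k 5 tbl4) _ p2.
have zu i : i != 0%N -> mul (T 5 tbl4) (z i) u = 0.
  move=> i0; apply/eqP; rewrite -memv0.
  suffices /subvP/(_ u p2') : (<<map z (unzip2 tbl4)>> <=
    mul (T 5 tbl4) (z i) @^-1: 0)%VS by rewrite -memv_preim.
  apply/span_subvP => _ /mapP[j j2 ->]; rewrite -memv_preim.
  apply: std_vec_mul_mem => r; rewrite !inE.
  by case: i i0 => // i _; move: j2; rewrite !inE => /or3P[] /eqP->.
(* Only the basis vector of index 0 acts on the square, so the factor is the coordinate of [x] along
   it. *)
exists ((x : 'rV[k]_5) 0 0).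
have xE : x = \sum_(i < 5) (x : 'rV[k]_5) 0 i *: z i.
  by rewrite [LHS]row_sum_delta; apply: eq_bigr => i _; rewrite /z std_vec_delta.
rewrite {1}xE amul_suml (bigD1 ord0) // big1 ?addr0 => [|i ni]; last first.
  by rewrite amulZl zu ?scaler0.
by rewrite [LHS]addr0 amulZl.
Qed.

Lemma M_mul p q r : (p, q, r) \in tblM ->
  mul M (std_vec k 5 tblM p) (std_vec k 5 tblM q) = std_vec k 5 tblM r.
Proof.
move=> in_tb; apply: std_vec_mul_entry => //;
by move: in_tb; rewrite !inE => /or4P[] /eqP[? ? ?]; subst.
Qed.

Lemma M_not_isomorphic : ~ isomorphic M (T 5 tbl4).
Proof.
move=> iso; pose y := std_vec k 5 tblM.
have := isomorphic_parallel iso tbl4_parallel (y 0%N) (y 1%N) (y 0%N) (y 1%N).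
rewrite (M_mul (r := 2)) // (M_mul (r := 3)) // (M_mul (r := 4)) // => /negP[].
exact: (@std_vec_free k 5 tblM [:: 3; 4]%N).
Qed.

(** In the weights 1, 4, 5, 6, 7 the extra product y_1 y_2 = y_4 has 4 + 5 > 7 and disappears in the
    limit. *)
Lemma long_chain_M : degeneration_chain 5 M.
Proof.
exists (T 5 tbl4); split; [|exact: M_not_isomorphic|exact: chain_tbl4_dim5].
pose y i := std_vec k 5 tblM i.
apply: (chain_table_degenerates (@table_anticommutative _ _ _) (table_dim _ _ _)
  (_ : chain_table tbl4 [:: 1; 4; 5; 6; 7] 7 (size (map y [:: 0; 1; 2; 3; 4]%N)))) => //.
  exact: std_vec_free.
by apply/allP => t; rewrite !inE => /or3P[] /eqP->; apply/eqP; apply: std_vec_mul_entry.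
Qed.

(** With weights 1, ..., 5 on the basis the products of [tblM] survive, since the last hypothesis
    gives b c a component along [e]. *)
Lemma long_chain_dim5 (A : algebra k) (a b c d e : A) :
    anticommutative A -> ~ nilpotent A -> \dim {:A} = 5%N ->
    free [:: a; b; c; d; e] -> mul A a b = c -> mul A a c = d -> mul A a d = e ->
    mul A b c \notin <<[:: a; b; c; d]>>%VS ->
  degeneration_chain 6 A.
Proof.
move=> hA nA dA fh ab ac ad bc.
have bX : basis_of {:A} [:: a; b; c; d; e].
  by rewrite basisEfree fh subvf dA.
have [u [s [us bcE]]] : exists u s, u \in <<[:: a; b; c; d]>>%VS /\ mul A b c = u + s *: e.
  have : mul A b c \in <<[:: a; b; c; d] ++ [:: e]>>%VS.
    by rewrite (span_basis bX) memvf.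
  rewrite span_cat span_seq1 => /memv_addP[u us [_ /vlineP[s ->] ->]].
  by exists u, s.
have s0 : s != 0 by apply: contraNneq bc => s0; rewrite bcE s0 scale0r addr0.
(* Scaling b, c, d, e by [r] makes the coefficient of the last basis vector in the product of the
   second and third equal to 1, and keeps the products by [a]. *)
pose r := s^-1; have r0 : r != 0 by rewrite invr_eq0.
pose X := [tuple a; r *: b; r *: c; r *: d; r *: e].
have memX (x : A) : r *: x \in X -> x \in <<X>>%VS.
  by move=> Xx; rewrite -[x](scalerK r0) memvZ // memv_span.
have bX' : basis_of {:A} X.
  rewrite basisEdim size_tuple dA leqnn andbT -(span_basis bX).
  apply/span_subvP => x; rewrite !inE => /or4P[/eqP->|/eqP->|/eqP->|/orP[] /eqP->].
  - by rewrite memv_span // !inE eqxx.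
  - by apply: memX; rewrite !inE eqxx !orbT.
  - by apply: memX; rewrite !inE eqxx !orbT.
  - by apply: memX; rewrite !inE eqxx !orbT.
  - by apply: memX; rewrite !inE eqxx !orbT.
exists M; split; last exact: long_chain_M.
  pose w := nth 6%N [:: 1; 2; 3; 4; 5]%N.
  apply: (degenerates_table (w := w) hA bX') => [p q t|].
    by rewrite !inE => /or4P[] /eqP[-> -> ->].
  have fX := basis_free bX'.
  have uk : uniq (unzip1 tblM) by [].
  have cX (p : 'I_5) p' : (p' < 5)%N -> coord X p X`_p' = (p == p' :> nat)%:R.
    move=> lt_p'; rewrite -[p']/(nat_of_ord (Ordinal lt_p')) (coord_free _ _ fX).
    by rewrite eq_sym.
  have wX (p : 'I_5) : (w p <= 5)%N by case: p => [[|[|[|[|[|]]]]]].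
  have coordr (p : 'I_5) x : coord X p (r *: x) = 0 -> coord X p x = 0.
    by rewrite linearZ => /eqP; rewrite mulf_eq0 (negPf r0) => /eqP.
  have u4 (p : 'I_5) : p = 4%N :> nat -> coord X p u = 0.
    move=> p4; apply: coord_span_eq0 us => x.
    rewrite !inE => /or4P[] /eqP->; first by rewrite (cX _ 0%N) // p4.
    - by apply: coordr; rewrite (cX _ 1%N) // p4.
    - by apply: coordr; rewrite (cX _ 2%N) // p4.
    - by apply: coordr; rewrite (cX _ 3%N) // p4.
  have entry p q t (l : 'I_5) : mul A X`_p X`_q = X`_t -> (p, q, t) \in tblM ->
      coord X l (mul A X`_p X`_q) = (count_mem (p, q, l : nat) tblM)%:R.
    move=> -> in_tb; rewrite (count_entry _ uk in_tb) cX //.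
    by move: in_tb; rewrite !inE => /or4P[] /eqP[_ _ ->].
  move=> i j l lt le; have le5 := leq_trans le (wX l).
  (* The bound [w i + w j <= 5] leaves the pairs (0,1), (0,2), (0,3) and (1,2), the last only for
     the coordinate of index 4. *)
  case: i lt le le5 => [[|[|[|[|[|//]]]]] lti]; case: j => [[|[|[|[|[|//]]]]] ltj] //= _ le _.
  - by apply: (entry 0 1 2)%N; rewrite //= amulZr ab.
  - by apply: (entry 0 2 3)%N; rewrite //= amulZr ac.
  - by apply: (entry 0 3 4)%N; rewrite //= amulZr ad.
  have l4 : l = 4%N :> nat by case: l le => [[|[|[|[|[|]]]]]].
  rewrite l4 amulZl amulZr bcE scalerDr scalerA mulVf // scale1r scalerDr.
  have -> : r *: (r *: u) + r *: e = X`_4 + r *: (r *: u) by rewrite addrC.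
  rewrite [LHS]linearD [X in X + _](cX l 4%N) //.
  by rewrite !linearZ /= (u4 l l4) !mulr0 addr0 l4.
move=> /isomorphic_nilpotent iso; exact/nA/iso/M_nilpotent.
Qed.

End LongChains.

Lemma mem_span_consP (k : fieldType) (V : vectType k) (x : V) s v :
  reflect (exists c, v - c *: x \in <<s>>%VS) (v \in <<x :: s>>%VS).
Proof.
rewrite span_cons; apply: (iffP memv_addP) => [[_ /vlineP[c ->] [w ws ->]]|[c vs]].
  by exists c; rewrite addrC addKr.
by exists (c *: x); [rewrite memvZ // memv_line | exists (v - c *: x); rewrite // addrC subrK].
Qed.

(** * Vector identities by coordinates *)

Section VectorRing.
Variables (k : fieldType) (V : vectType k).
Local Notation xi := (coord (vbasis {:V})).

Lemma coord_ext (u v : V) : (forall i, xi i u = xi i v) -> u = v.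
Proof.
move=> uv; rewrite (coord_vbasis (memvf u)) (coord_vbasis (memvf v)).
by apply: eq_bigr => i _; rewrite uv.
Qed.

Lemma xiD i (u v : V) : xi i (u + v) = xi i u + xi i v. Proof. exact: linearD. Qed.
Lemma xiN i (u : V) : xi i (- u) = - xi i u. Proof. exact: linearN. Qed.
Lemma xiZ i c (u : V) : xi i (c *: u) = c * xi i u. Proof. exact: linearZ. Qed.
Lemma xi0 i : xi i (0 : V) = 0. Proof. exact: linear0. Qed.

End VectorRing.

Ltac vring := apply: coord_ext => ?; rewrite ?(xiD, xiN, xiZ, xi0); ring.

(** * Nilpotency in dimension five *)

Section DimensionFive.
Variables (k : closedFieldType) (A : algebra k).
Hypotheses (hA : anticommutative A) (eA : engel A).
Local Notation "x ** y" := (mul A x y) (at level 40, left associativity).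

Lemma engel_eigen2 (a b : A) s : a ** (a ** b) = s *: b -> s = 0 \/ b = 0.
Proof.
move=> ab; have [m _ em] := eA.
have : iter (m * 2) (left_mul a) b = s ^+ m *: b.
  elim: (m) => [|i IH]; first by rewrite scale1r.
  by rewrite mulSn iterD IH /= /left_mul !amulZr ab scalerA exprSr.
rewrite muln2 -addnn iterD em => /esym/eqP.
by rewrite scaler_eq0 expf_eq0 => /orP[/andP[_ /eqP->]|/eqP->]; [left|right].
Qed.

(** Take the least m with L_b^m a = 0. If m > 2, applying L_b^(m-1) and then L_b^(m-2) to the
    relation gives p = 0 and r = 0; now q b lies in the image of L_b, hence is 0. *)
Lemma engel_square0 (a b : A) p q r :
  b ** (b ** a) = p *: a + q *: b + r *: (b ** a) -> b ** (b ** a) = 0.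
Proof.
move=> rel; have [m0 _ em] := eA; pose L n (x : A) : A := iter n (left_mul b) x.
have LD n x y : L n (x + y) = L n x + L n y.
  by elim: n => //= n IH; rewrite IH /left_mul amulDr.
have LZ n c x : L n (c *: x) = c *: L n x.
  by elim: n => //= n IH; rewrite IH /left_mul amulZr.
have Lb n : L n.+1 b = 0.
  by rewrite /L iterSr /left_mul hA; elim: n => //= n ->; rewrite /left_mul amul0r.
have Lab n : L n (b ** a) = L n.+1 a by rewrite /L iterSr.
have Labb n : L n (b ** (b ** a)) = L n.+2 a by rewrite /L !iterSr.
have ex0 : exists m, L m a == 0 by exists m0; rewrite [L _ _]em.
case: (ex_minnP ex0) => m /eqP Lm0 minm.
have big n : (m <= n)%N -> L n a = 0.
  move=> le; rewrite /L -(subnK le) iterD -/(L m a) Lm0.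
  by elim: (n - m)%N => //= i ->; rewrite /left_mul amul0r.
move: m Lm0 minm big => [|[|[|m]]] Lm0 minm big; try exact: (big 2%N).
have nz : L m.+2 a != 0 by apply/negP => /minm; rewrite ltnn.
have [L3 L4] : L m.+3 a = 0 /\ L m.+4 a = 0 by rewrite !big.
have p0 : p = 0.
  have := congr1 (L m.+2) rel; rewrite Labb !LD !LZ Lb Lab L3 L4 ?(scaler0, addr0).
  by move/esym/eqP; rewrite scaler_eq0 (negPf nz) orbF => /eqP.
have r0 : r = 0.
  have := congr1 (L m.+1) rel; rewrite Labb !LD !LZ Lb Lab p0 L3 ?(scale0r, scaler0, add0r).
  by move/esym/eqP; rewrite scaler_eq0 (negPf nz) orbF => /eqP.
rewrite p0 r0 !scale0r add0r addr0 in rel.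
have [q0|b0] := engel_notin_image hA eA rel; rewrite rel ?q0 ?b0 ?scale0r ?scaler0 //.
Qed.

(** Subtracting a multiple of [a] from [b] removes the term in a(ab) and does not change ab, so that
    [engel_square0] applies. *)
Lemma engel_multiple (a b : A) :
    b ** (a ** b) \in <<[:: a; b; a ** b; a ** (a ** b)]>>%VS ->
  exists s, b ** (a ** b) = s *: (a ** (a ** b)).
Proof.
case/mem_span_consP=> p /mem_span_consP[q /mem_span_consP[r]].
rewrite span_seq1 => /vlineP[s rel]; exists s.
have bE : b ** (a ** b) = p *: a + q *: b + r *: (a ** b) + s *: (a ** (a ** b)).
  by rewrite -rel; vring.
pose b1 := b - s *: a.
have ab1 : a ** b1 = a ** b by rewrite /b1 amulBr amulZr hA scaler0 subr0.
have b1c : b1 ** (a ** b) = p *: a + q *: b + r *: (a ** b).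
  by rewrite /b1 amulBl amulZl bE; vring.
have /engel_square0 e : b1 ** (b1 ** a) = - (p + q * s) *: a + - q *: b1 + r *: (b1 ** a).
  by rewrite (amulC hA b1 a) ab1 amulNr b1c /b1; vring.
move: e; rewrite (amulC hA b1 a) ab1 amulNr => /eqP; rewrite oppr_eq0 => /eqP.
by rewrite /b1 amulBl amulZl => /eqP; rewrite subr_eq0 => /eqP.
Qed.

(** The last hypothesis, evaluated at perturbations of a normalised b, and the Engel condition leave
    only the products ab = c, ac = d, ad = e up to sign. *)
Lemma dim5_nilpotent (a b : A) :
    \dim {:A} = 5%N -> a ** (a ** (a ** b)) != 0 ->
    a ** (a ** (a ** (a ** b))) = 0 ->
    (forall b', a ** (a ** (a ** b')) != 0 ->
      b' ** (a ** b') \in <<[:: a; b'; a ** b'; a ** (a ** b')]>>%VS) ->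
  nilpotent A.
Proof.
move=> dA e0 ae0 bad.
have mult b' : a ** (a ** (a ** b')) != 0 ->
    exists s, b' ** (a ** b') = s *: (a ** (a ** b')).
  by move=> /bad; apply: engel_multiple.
have [s0 s0E] := mult _ e0.
(* This change keeps ab and makes b(ab) vanish. *)
pose b0 := b - s0 *: a.
have [c ab] : exists c, a ** b0 = c by exists (a ** b0).
have abE : a ** b = c by rewrite -ab /b0 amulBr amulZr hA scaler0 subr0.
have [d ac] : exists d, a ** c = d by exists (a ** c).
have [e ad] : exists e, a ** d = e by exists (a ** d).
rewrite abE ac ad in e0 ae0 s0E.
have bc : b0 ** c = 0 by rewrite /b0 amulBl amulZl s0E ac subrr.
move: b0 ab bc => {abE s0E s0} b ab bc.
have E := (amulDl, amulDr, amulZl, amulZr, hA, ab, ac, ad, ae0, bc).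
have fr : free [:: a; b; c; d; e].
  by have := @engel_free_chain _ _ hA eA a b; rewrite !E; apply.
have d0 : d != 0 by apply: contraNneq e0 => d0; rewrite -ad d0 amul0r.
have eig x s : x ** d = s *: d -> s = 0.
  by case/(engel_eigen eA) => // d0'; rewrite d0' eqxx in d0.
have de0 : free [:: d; e] by have := fr; rewrite !free_cons => /and4P[_ _ _].
have fde p q := @free2P _ _ d e p q de0.
(* [mult] at b + t c; since bc = cc = 0 only two terms remain. *)
have mc t : exists s, t *: (b ** d) + t ^+ 2 *: (c ** d) = s *: (d + t *: e).
  have := mult (b + t *: c); rewrite !E ?(scaler0, addr0, add0r) => /(_ e0).
  by case=> s rel; exists s; rewrite expr2 -scalerA.
have mcW : b ** d \in <<[:: d; e]>>%VS /\ c ** d \in <<[:: d; e]>>%VS.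
  pose f i := nth 0 [:: b ** d; c ** d] i.
  have h : forall i, (i < 2)%N -> f i \in <<[:: d; e]>>%VS.
    apply: (memv_cofinite (bad := [:: 0])) => t; rewrite inE => t0.
    have [s] := mc t; rewrite !big_ord_recl big_ord0 /f /= expr0 scale1r addr0 expr1.
    move=> /(congr1 ( *:%R t^-1)).
    rewrite scalerDr !scalerA expr2 !mulrA mulVf // scale1r mul1r => ->.
    by rewrite memvZ // memvD ?memvZ // memv_span // !inE eqxx ?orbT.
  by split; [apply: (h 0%N) | apply: (h 1%N)].
have [[p [q bd]] [p' [q' cd]]] : (exists p q, b ** d = p *: d + q *: e) /\
    (exists p q, c ** d = p *: d + q *: e).
  have two x : x \in <<[:: d; e]>>%VS -> exists p q, x = p *: d + q *: e.
    case/mem_span_consP=> p; rewrite span_seq1 => /vlineP[q xE]; exists p, q.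
    by rewrite -xE addrC subrK.
  by split; apply: two; case: mcW.
(* The coordinates along [d] and [e] of the relation [mc], with [s] eliminated and a factor [t]
   divided out. *)
have poly t : t != 0 -> q + t * (q' - p) - t ^+ 2 * p' = 0.
  move=> t0; have [s] := mc t; rewrite bd cd => rel.
  have : (t * p + t ^+ 2 * p' - s) *: d + (t * q + t ^+ 2 * q' - s * t) *: e = 0.
    by rewrite -[RHS](subrr (s *: (d + t *: e))) -{1}rel; vring.
  case/fde => e1 e2; apply: (mulfI t0); rewrite mulr0 -[RHS]e2.
  by rewrite (_ : s = t * p + t ^+ 2 * p'); [ring | apply/esym/eqP; rewrite -subr_eq0 e1].
have [q0 q'p p'0] : [/\ q = 0, q' = p & p' = 0].
  have P0 : \poly_(i < 3) [:: q; q' - p; - p']`_i = 0.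
    apply: (poly_cofinite_roots (bad := [:: 0])) => t; rewrite inE => /poly <-.
    rewrite horner_poly !big_ord_recl big_ord0 /= expr0 expr1 /bump /=; ring.
  have cf i : (i < 3)%N -> [:: q; q' - p; - p']`_i = 0.
    by move=> lt; have := coef0 k i; rewrite -P0 coef_poly lt.
  split; [exact: (cf 0%N) | | ].
    by apply/eqP; rewrite -subr_eq0; apply/eqP/(cf 1%N).
  by apply/eqP; rewrite -oppr_eq0; apply/eqP/(cf 2%N).
rewrite q0 scale0r addr0 in bd; have p0 := eig _ _ bd.
rewrite q'p p'0 p0 !scale0r addr0 in cd; rewrite p0 scale0r in bd.
have dc : d ** c = 0 by rewrite amulC // cd oppr0.
have cb : c ** b = 0 by rewrite amulC // bc oppr0.
have da : d ** a = - e by rewrite amulC // ad.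
(* [mult] at b + t d, where a(a(b + t d)) is still d. *)
have [bed ded] : b ** e \in <[d]>%VS /\ d ** e \in <[d]>%VS.
  pose f i := nth 0 [:: b ** e; d ** e] i.
  have h : forall i, (i < 2)%N -> f i \in <[d]>%VS.
    apply: (memv_cofinite (bad := [:: 0])) => t; rewrite inE => t0.
    have := mult (b + t *: d); rewrite !(E, ad, dc, amul0r, scaler0, addr0, add0r) => /(_ e0)[s].
    rewrite !big_ord_recl big_ord0 /f /= expr0 scale1r addr0 expr1.
    rewrite -scalerDr => /(congr1 ( *:%R t^-1)); rewrite scalerK // => ->.
    by rewrite !memvZ ?memv_line.
  by split; [apply: (h 0%N) | apply: (h 1%N)].
have [mu be] := vlineP _ _ bed; have [ka de] := vlineP _ _ ded.
have ka0 : ka = 0.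
  have /eig/eqP : e ** d = - ka *: d by rewrite amulC // de scaleNr.
  by rewrite oppr_eq0 => /eqP.
rewrite ka0 scale0r in de.
have [nu ec] : exists s, e ** c = s *: d.
  have := mult (b + e); rewrite !(E, ad, ae0, amul0r, scaler0, addr0, add0r) => /(_ e0)[s].
  by move=> sE; exists s.
(* [d] is an eigenvector of the square of L_(a+b) with eigenvalue [mu]; a + c serves likewise for
   [nu]. *)
have mu0 : mu = 0.
  have : (a + b) ** ((a + b) ** d) = mu *: d.
    by rewrite !(E, ad, bd, be, amul0r, addr0, add0r).
  by case/engel_eigen2 => // d0'; rewrite d0' eqxx in d0.
have nu0 : nu = 0.
  have : (a + c) ** ((a + c) ** d) = - nu *: d.
    by rewrite !(E, ad, cd, amul0r, addr0, add0r) amulC // ec scaleNr.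
  case/engel_eigen2 => [/eqP|d0']; last by rewrite d0' eqxx in d0.
  by rewrite oppr_eq0 => /eqP.
rewrite mu0 scale0r in be; rewrite nu0 scale0r in ec.
have bX : {:A}%VS = <<[:: a; b; c; d; e]>>%VS.
  by apply/esym/eqP; rewrite eqEdim subvf dA (eqP fr).
have ce : c ** e = 0 by rewrite amulC // ec oppr0.
have [ba ca ea] : [/\ b ** a = - c, c ** a = - d & e ** a = 0].
  by split; rewrite amulC // ?ab ?ac ?ae0 ?oppr0.
have [db eb ed] : [/\ d ** b = 0, e ** b = 0 & e ** d = 0].
  by split; rewrite amulC // ?bd ?be ?de ?oppr0.
have mulE := (hA, (ab, ac, ad, ae0), (ba, bc, bd, be), (ca, cb, cd, ce), (da, db, dc, de),
  (ea, eb, ec, ed)).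
(* The span of the list of index [i] contains the power of index [i.+1]. *)
pose S := [:: [:: a; b; c; d; e]; [:: c; d; e]; [:: d; e]; [:: e]; [::]].
have step i x z : (i < 4)%N -> x \in [:: a; b; c; d; e] -> z \in nth [::] S i ->
    x ** z \in <<nth [::] S i.+1>>%VS.
  case: i => [|[|[|[|//]]]] _ /=; rewrite !inE => Hx Hz;
  repeat match goal with H : is_true (_ || _) |- _ => case/orP: H => H end;
  by move/eqP: Hx => ->; move/eqP: Hz => ->;
     rewrite mulE ?memvN ?mem0v // memv_span // !inE eqxx ?orbT.
have pow i : (i < 5)%N -> (power A i.+1 <= <<nth [::] S i>>)%VS.
  elim: i => [|i IH] lt; first by rewrite /= -bX subvv.
  by apply: (powerSS_span hA bX (IH (ltnW lt))) => x z; apply: step.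
exists 5%N => //; apply/eqP; rewrite -subv0.
by have := pow 4%N isT; rewrite /= span_nil.
Qed.

End DimensionFive.

(** * A nilpotency criterion by ideals *)

Section NilpotencyCriterion.
Variables (k : fieldType) (A : algebra k).
Hypothesis hA : anticommutative A.
Local Notation "x ** y" := (mul A x y) (at level 40, left associativity).
Implicit Types U : {vspace A}.

Definition is_ideal U := forall x u, u \in U -> x ** u \in U.

(** On U0 modulo U1 the squares of all L_a vanish, so the L_a anticommute. Run through a basis of A:
    if [x] does not kill [u] modulo U1, replace [u] by xu, which is killed by [x] and still by the
    basis vectors treated before. *)
Lemma exists_annihilated U0 U1 : is_ideal U0 -> is_ideal U1 ->
    (forall a u, u \in U0 -> a ** (a ** u) \in U1) -> ~~ (U0 <= U1)%VS ->
  exists u, [/\ u \in U0, u \notin U1 & forall x, x ** u \in U1].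
Proof.
move=> i0 i1 sq nle.
suffices [u [u0 u1 hu]] : exists u,
    [/\ u \in U0, u \notin U1 & forall x, x \in tval (vbasis {:A}) -> x ** u \in U1].
  exists u; split=> // x; rewrite (coord_vbasis (memvf x)) amul_suml.
  apply: memv_suml => i _; rewrite amulZl memvZ // hu //.
  by apply: mem_nth; rewrite size_tuple.
elim: (tval (vbasis {:A})) => [|x s [u [u0 u1 hu]]].
  by have [u u0 u1] := subvPn nle; exists u.
have [xu|nxu] := boolP (x ** u \in U1).
  by exists u; split=> // y; rewrite inE => /predU1P[->|/hu].
exists (x ** u); split=> [||y]; [exact: i0|by []|].
rewrite inE => /predU1P[->|ys]; first exact: sq.
have -> : y ** (x ** u) = (x + y) ** ((x + y) ** u) - x ** (x ** u)
    - y ** (y ** u) - x ** (y ** u).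
  by rewrite !amulDl !amulDr; vring.
by rewrite !memvB ?sq // i1 // hu.
Qed.

(** Induction on the codimension of U1 in U0: enlarge U1 by some [u] with Au in U1; once a power
    lies in the larger ideal, the next lies in U1. *)
Lemma power_sub_ideal U0 U1 i : (U1 <= U0)%VS -> is_ideal U0 -> is_ideal U1 ->
    (forall a u, u \in U0 -> a ** (a ** u) \in U1) -> (power A i.+1 <= U0)%VS ->
  exists m, (power A m.+1 <= U1)%VS.
Proof.
move=> U10 i0 + + pU0; have [n] := ubnP (\dim U0 - \dim U1).
elim: n U1 U10 => // n IH U1 U10 lt_n i1 sq.
have [le|nle] := boolP (U0 <= U1)%VS; first by exists i; apply: subv_trans le.
have [u [u0 u1 hu]] := exists_annihilated i0 i1 sq nle.
pose U := (U1 + <[u]>)%VS.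
have U1U : (U1 <= U)%VS by apply: addvSl.
have uU : u \in U by rewrite (subvP (addvSr _ _)) // memv_line.
have UU1 x w : w \in U -> x ** w \in U1.
  case/memv_addP=> v v1 [_ /vlineP[c ->] ->].
  by rewrite amulDr amulZr memvD ?memvZ // i1.
have lt_dim : (\dim U1 < \dim U)%N.
  rewrite (ltn_leqif (dimv_leqif_sup U1U)); apply: contra u1 => /subvP; exact.
have UU0 : (U <= U0)%VS by rewrite subv_add U10 -memvE.
have le_dim := dimvS UU0.
have [|||m pm] := IH U UU0.
- by lia.
- by move=> x w wU; apply/(subvP U1U)/UU1.
- by move=> a w wU; apply/(subvP U1U)/sq.
by exists m.+1; apply: powerSS_sub => // x w wp; apply/UU1/(subvP pm).
Qed.

Lemma nilpotent_of_ideal U : is_ideal U ->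
    (forall a x, a ** (a ** x) \in U) ->
    (forall a u, u \in U -> a ** (a ** u) = 0) ->
  nilpotent A.
Proof.
move=> iU sq sq0.
have full : is_ideal fullv by move=> x u _; apply: memvf.
have [m pm] := power_sub_ideal (i := 0%N) (subvf U) full iU (fun a u _ => sq a u) (subvv _).
have i0 : is_ideal 0%VS by move=> x u; rewrite memv0 => /eqP->; rewrite amul0r mem0v.
have sq0' a u : u \in U -> a ** (a ** u) \in 0%VS by move=> uU; rewrite sq0 ?mem0v.
have [m' pm'] := power_sub_ideal (sub0v U) iU i0 sq0' pm.
by exists m'.+1 => //; apply/eqP; rewrite -subv0.
Qed.

End NilpotencyCriterion.

Lemma free2_line (k : fieldType) (V : vectType k) (u v : V) :
  ~~ free [:: u; v] -> u != 0 -> v \in <[u]>%VS.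
Proof.
rewrite free_cons seq1_free span_seq1 negb_and !negbK => /orP[|/eqP->]; last by rewrite mem0v.
case/vlineP=> c uE u0; have c0 : c != 0.
  by apply: contraNneq u0 => c0; rewrite uE c0 scale0r.
by rewrite -(scalerK c0 v) -uE memvZ // memv_line.
Qed.

Lemma line_eq (k : fieldType) (V : vectType k) (u v : V) :
  u \in <[v]>%VS -> u != 0 -> v \in <[u]>%VS.
Proof.
move=> uv; apply: free2_line; rewrite free_cons span_seq1 uv //.
Qed.

(** * Comparing coefficients in a parameter *)

Section Coefficients.
Variables (k : closedFieldType) (V : vectType k).
Implicit Types (W : {vspace V}) (u v w : V) (s t : k).

Lemma memv_cofinite3 W (bad : seq k) u v w :
    (forall s, s \notin bad -> u + s *: v + s ^+ 2 *: w \in W) ->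
  [/\ u \in W, v \in W & w \in W].
Proof.
move=> h; have c := @memv_cofinite k V W bad 3 (nth 0 [:: u; v; w]).
have {}c : forall i, (i < 3)%N -> nth 0 [:: u; v; w] i \in W.
  apply: c => s /h; rewrite !big_ord_recl big_ord0 /= /bump /=.
  by rewrite expr0 scale1r expr1 addr0 addrA.
by split; [apply: (c 0%N) | apply: (c 1%N) | apply: (c 2%N)].
Qed.

Lemma memv_cofinite5 W (bad : seq k) u v w x y :
    (forall s, s \notin bad ->
      u + s *: v + s ^+ 2 *: w + s ^+ 3 *: x + s ^+ 4 *: y \in W) ->
  [/\ u \in W, v \in W & w \in W].
Proof.
move=> h; have c := @memv_cofinite k V W bad 5 (nth 0 [:: u; v; w; x; y]).
have {}c : forall i, (i < 5)%N -> nth 0 [:: u; v; w; x; y] i \in W.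
  apply: c => s /h; rewrite !big_ord_recl big_ord0 /= /bump /=.
  by rewrite expr0 scale1r expr1 addr0 !addrA.
by split; [apply: (c 0%N) | apply: (c 1%N) | apply: (c 2%N)].
Qed.

(** As [p] is invertible, the vector coefficients vanish one after the other, from the lowest power
    of [s]. *)
Lemma scale_cancel (p q r : k) u v w : p != 0 ->
    (forall s, (p + s * q + s ^+ 2 * r) *: (u + s *: v + s ^+ 2 *: w) = 0) ->
  [/\ u = 0, v = 0 & w = 0].
Proof.
move=> p0 h.
have [] := @memv_cofinite5 0%VS [::] (p *: u) (p *: v + q *: u)
  (p *: w + q *: v + r *: u) (q *: w + r *: v) (r *: w).
  move=> s _; rewrite memv0 -(h s); apply/eqP; vring.
rewrite !memv0 scaler_eq0 (negPf p0) => /eqP-> /=.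
rewrite !scaler0 !addr0 scaler_eq0 (negPf p0) => /eqP-> /=.
by rewrite !scaler0 addr0 scaler_eq0 (negPf p0) => /eqP->.
Qed.

(** The quadratic vector is a scalar times d + t v for each t; comparing coordinates shows this
    scalar to be r + t r'. *)
Lemma pencil d v u0 u1 u2 : free [:: d; v] ->
    (forall t, u0 + t *: u1 + t ^+ 2 *: u2 \in <[d + t *: v]>%VS) ->
  exists r r', [/\ u0 = r *: d, u1 = r *: v + r' *: d & u2 = r' *: v].
Proof.
move=> fr h.
have fdv p q := @free2P _ _ d v p q fr.
have [m0 m1 m2] : [/\ u0 \in <<[:: d; v]>>%VS, u1 \in <<[:: d; v]>>%VS & u2 \in <<[:: d; v]>>%VS].
  apply: (memv_cofinite3 (bad := [::])) => t _; have /vlineP[c ->] := h t.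
  by rewrite memvZ // memvD ?memvZ // memv_span // !inE eqxx ?orbT.
have two x : x \in <<[:: d; v]>>%VS -> exists p q, x = p *: d + q *: v.
  case/mem_span_consP=> p; rewrite span_seq1 => /vlineP[q xE]; exists p, q.
  by rewrite -xE addrC subrK.
have [p0 [q0 e0]] := two _ m0; have [p1 [q1 e1]] := two _ m1.
have [p2 [q2 e2]] := two _ m2.
have poly t : q0 + t * (q1 - p0) + t ^+ 2 * (q2 - p1) - t ^+ 3 * p2 = 0.
  have /vlineP[c rel] := h t.
  have /fdv[c1 c2] : (p0 + t * p1 + t ^+ 2 * p2 - c) *: d +
      (q0 + t * q1 + t ^+ 2 * q2 - c * t) *: v = 0.
    by rewrite -[RHS](subrr (c *: (d + t *: v))) -{1}rel e0 e1 e2; vring.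
  have cE : c = p0 + t * p1 + t ^+ 2 * p2 by apply/esym/eqP; rewrite -subr_eq0 c1.
  by rewrite -[RHS]c2 cE; ring.
have cf i : (i < 4)%N -> [:: q0; q1 - p0; q2 - p1; - p2]`_i = 0.
  have P0 : \poly_(i < 4) [:: q0; q1 - p0; q2 - p1; - p2]`_i = 0.
    apply: (poly_cofinite_roots (bad := [::])) => t _; rewrite -(poly t).
    by rewrite horner_poly !big_ord_recl big_ord0 /= /bump /= expr0 expr1; ring.
  by move=> lt; have := coef0 k i; rewrite -P0 coef_poly lt.
have q00 : q0 = 0 := cf 0%N isT.
have q10 : q1 = p0 by apply/eqP; rewrite -subr_eq0; apply/eqP/(cf 1%N).
have q21 : q2 = p1 by apply/eqP; rewrite -subr_eq0; apply/eqP/(cf 2%N).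
have p20 : p2 = 0 by apply/eqP; rewrite -oppr_eq0; apply/eqP/(cf 3%N).
exists p0, p1; rewrite e0 e1 e2 q00 q10 q21 p20 !scale0r addr0 add0r; split=> //.
by rewrite addrC.
Qed.

End Coefficients.

Lemma eq_combine (k : fieldType) (V : vectType k) (p q u v : V) :
  p = q -> u - v = p - q -> u = v.
Proof. by move=> -> /eqP; rewrite subrr subr_eq0 => /eqP. Qed.

(** * Squares L_a^2 of rank at most one *)

Section RankOne.
Variables (k : closedFieldType) (A : algebra k).
Hypotheses (hA : anticommutative A) (eA : engel A).
Local Notation "x ** y" := (mul A x y) (at level 40, left associativity).
Hypothesis cube0 : forall a x, a ** (a ** (a ** x)) = 0.
Hypothesis rank1 : forall a x y, ~~ free [:: a ** (a ** x); a ** (a ** y)].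
Local Notation amulE := (@amulDl k A, @amulDr k A, @amulZl k A, @amulZr k A,
  @amulNl k A, @amulNr k A).

Lemma square_line a x y : a ** (a ** x) != 0 -> a ** (a ** y) \in <[a ** (a ** x)]>%VS.
Proof. exact: free2_line. Qed.

Lemma cube0_linear a x b :
  a ** (a ** (x ** b)) + a ** (x ** (a ** b)) + x ** (a ** (a ** b)) = 0.
Proof.
have h s : s \notin [::] -> 0 +
    s *: (a ** (a ** (x ** b)) + a ** (x ** (a ** b)) + x ** (a ** (a ** b))) +
    s ^+ 2 *: (a ** (x ** (x ** b)) + x ** (a ** (x ** b)) + x ** (x ** (a ** b))) +
    s ^+ 3 *: 0 + s ^+ 4 *: 0 \in (0%VS : {vspace A}).
  move=> _; rewrite memv0; apply/eqP; rewrite -[RHS](cube0 (a + s *: x) b) !amulE !cube0.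
  vring.
by have [_ + _] := memv_cofinite5 h; rewrite memv0 => /eqP.
Qed.

(** * Dependent case: all squares in a fixed line *)

Section FixedLine.
Hypothesis par : forall x y, ~~ free [:: x ** (x ** y); y ** (x ** y)].

(** If a(ay) is nonzero, [par] and [rank1] put y(ay) into the line of d. This applies to x + s b for
    all but one [s]; then compare coefficients of s^0. *)
Lemma fixed_line_swap a b x : a ** (a ** b) != 0 -> x ** (a ** x) \in <[a ** (a ** b)]>%VS.
Proof.
set d := a ** (a ** b) => d0.
have line y : a ** (a ** y) != 0 -> y ** (a ** y) \in <[d]>%VS.
  move=> y0; have /subvP := square_line y d0; rewrite -/d => h.
  suffices : (<[a ** (a ** y)]> <= <[d]>)%VS by move/subvP; apply; apply: free2_line.
  by rewrite -memvE square_line.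
have [l lE] := vlineP _ _ (square_line x d0); rewrite -/d in lE.
have [] := @memv_cofinite3 k A <[d]>%VS [:: - l] (x ** (a ** x))
  (x ** (a ** b) + b ** (a ** x)) (b ** (a ** b)) _ => // s; rewrite inE => ls.
have -> : x ** (a ** x) + s *: (x ** (a ** b) + b ** (a ** x)) + s ^+ 2 *: (b ** (a ** b))
    = (x + s *: b) ** (a ** (x + s *: b)) by rewrite !amulE; vring.
apply: line; rewrite !amulE lE -/d -scalerDl scaler_eq0 (negPf d0) orbF.
by rewrite addrC addr_eq0.
Qed.

Lemma fixed_line a b y x : a ** (a ** b) != 0 -> y ** (y ** x) \in <[a ** (a ** b)]>%VS.
Proof.
set d := a ** (a ** b) => d0; set w := y ** (y ** x).
have [->|w0] := eqVneq w 0; first exact: mem0v.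
have [xi xiE] := vlineP _ _ (square_line a w0); rewrite -/w in xiE.
have yay z : y ** (z ** y) = - (y ** (y ** z)) by rewrite (amulC hA z) amulNr.
have := fixed_line_swap y d0; rewrite -/d yay xiE memvN => xiw.
have [xi0|xi0] := eqVneq xi 0; last by rewrite -(scalerK xi0 w) memvZ.
(* Now y(ya) = 0. Replace [a] by a + s x: then y(y(a + s x)) = s w, so L_(a + s x)^2 b, if nonzero,
   spans the line of [w]; the coefficient of s^0 puts [d] into that line. *)
apply: line_eq d0.
have [] // := @memv_cofinite3 k A <[w]>%VS [:: 0] d
  (a ** (x ** b) + x ** (a ** b)) (x ** (x ** b)) _ => s; rewrite inE => s0.
have -> : d + s *: (a ** (x ** b) + x ** (a ** b)) + s ^+ 2 *: (x ** (x ** b))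
    = (a + s *: x) ** ((a + s *: x) ** b) by rewrite !amulE; vring.
set ds := (a + s *: x) ** ((a + s *: x) ** b).
have [->|ds0] := eqVneq ds 0; first exact: mem0v.
have sw : w \in <[ds]>%VS.
  have : y ** ((a + s *: x) ** y) \in <[ds]>%VS by apply: fixed_line_swap.
  rewrite yay !amulE xiE xi0 scale0r add0r memvN -/w => sw.
  by rewrite -(scalerK s0 w) memvZ.
exact: line_eq sw w0.
Qed.

Lemma nilpotent_of_fixed_line : nilpotent A.
Proof.
have [[a [b d0]]|none] := classic (exists a b, a ** (a ** b) <> 0); last first.
  apply: (nilpotent_of_ideal hA (U := 0%VS)) => [x u|a x|a u].
  - by rewrite memv0 => /eqP->; rewrite amul0r mem0v.
  - rewrite memv0; apply/eqP; apply: NNPP => n; apply: none; by exists a, x.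
  - by rewrite memv0 => /eqP->; rewrite !amul0r.
move/eqP: d0 => d0; set d := a ** (a ** b) in d0.
have ann x : x ** d = 0.
  have mid : a ** (x ** b) + x ** (a ** b) \in <[d]>%VS.
    have -> : a ** (x ** b) + x ** (a ** b) =
        (a + x) ** ((a + x) ** b) - a ** (a ** b) - x ** (x ** b).
      by rewrite !amulE; vring.
    by rewrite !memvB // fixed_line.
  have := cube0_linear a x b; rewrite -amulDr; have [r ->] := vlineP _ _ mid.
  by rewrite amulZr /d cube0 scaler0 add0r.
apply: (nilpotent_of_ideal hA (U := <[d]>%VS)) => [x u|x y|x u].
- by case/vlineP=> c ->; rewrite amulZr ann scaler0 mem0v.
- exact: fixed_line.
- by case/vlineP=> c ->; rewrite !amulZr ann amul0r scaler0.
Qed.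

End FixedLine.
End RankOne.

Lemma scalev_inj (k : fieldType) (V : vectType k) (v : V) : v != 0 ->
  injective (fun s : k => s *: v).
Proof.
move=> v0 s t /eqP; rewrite -subr_eq0 -scalerBl scaler_eq0 (negPf v0) orbF.
by rewrite subr_eq0 => /eqP.
Qed.

Lemma free2_of_notin (k : fieldType) (V : vectType k) (u v : V) :
  u != 0 -> v \notin <[u]>%VS -> free [:: u; v].
Proof. by move=> u0; apply: contraNT => /free2_line; apply. Qed.

(** * Independent case: factorisation of the squares *)

Section Config.
Variables (k : closedFieldType) (A : algebra k).
Hypotheses (hA : anticommutative A).
Local Notation "x ** y" := (mul A x y) (at level 40, left associativity).
Hypothesis rank1 : forall a x y, ~~ free [:: a ** (a ** x); a ** (a ** y)].
Local Notation amulE := (@amulDl k A, @amulDr k A, @amulZl k A, @amulZr k A,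
  @amulNl k A, @amulNr k A).

Variables (a b : A).
Local Notation c := (a ** b).
Local Notation d := (a ** (a ** b)).
Local Notation e := (b ** (a ** b)).
Hypothesis fde : free [:: d; e].

Let d0 : d != 0.
Proof. by have := free_not0 fde; apply; rewrite inE eqxx. Qed.

Let e0 : e != 0.
Proof. by have := free_not0 fde; apply; rewrite !inE eqxx orbT. Qed.

Let nline w : d \in <[w]>%VS -> e \in <[w]>%VS -> False.
Proof.
move=> /vlineP[p dE] /vlineP[q eE].
have [|p0 q0] := free2P (p := q) (q := - p) fde.
  by rewrite dE eE !scalerA mulNr scaleNr mulrC subrr.
by move: e0; rewrite eE p0 scale0r eqxx.
Qed.

Let fd v := coord [tuple d; e] ord0 v.
Let fe v := coord [tuple d; e] ord_max v.

Let fdd : fd d = 1. Proof. exact: (@coord_free _ _ _ [tuple d; e] ord0 ord0 fde). Qed.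
Let fdZ s v : fd (s *: v) = s * fd v. Proof. exact: linearZ. Qed.
Let fdD u v : fd (u + v) = fd u + fd v. Proof. exact: linearD. Qed.
Let fee : fe e = 1. Proof. exact: (@coord_free _ _ _ [tuple d; e] ord_max ord_max fde). Qed.
Let feZ s v : fe (s *: v) = s * fe v. Proof. exact: linearZ. Qed.
Let feD u v : fe (u + v) = fe u + fe v. Proof. exact: linearD. Qed.

(** By [rank1] these forms determine L_a^2 and L_b^2. Below, A splits into the span of a, b and the
    common kernel of [lam] and [mu]. *)
Let lam x := fd (a ** (a ** x)).
Let mu x := fe (b ** (b ** x)).

Let lamE x : a ** (a ** x) = lam x *: d.
Proof.
have [s sE] := vlineP _ _ (free2_line (rank1 a b x) d0).
by rewrite /lam sE fdZ fdd mulr1.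
Qed.

Let bba : b ** (b ** a) = - e. Proof. by rewrite (amulC hA b a) amulNr. Qed.

Let muE x : b ** (b ** x) = mu x *: e.
Proof.
have h0 : b ** (b ** a) != 0 by rewrite bba oppr_eq0 e0.
have := free2_line (rank1 b a x) h0; rewrite bba => /vlineP[s sE].
by rewrite /mu sE scalerN -scaleNr feZ fee mulr1.
Qed.

Let lama : lam a = 0. Proof. by rewrite /lam hA amul0r -(scale0r 0) fdZ mul0r. Qed.
Let lamb : lam b = 1. Proof. exact: fdd. Qed.
Let mua : mu a = - 1. Proof. by rewrite /mu bba -scaleN1r feZ fee mulr1. Qed.
Let mub : mu b = 0. Proof. by rewrite /mu hA amul0r -(scale0r 0) feZ mul0r. Qed.
Let lamD x y : lam (x + y) = lam x + lam y. Proof. by rewrite /lam !amulDr fdD. Qed.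
Let lamZ s x : lam (s *: x) = s * lam x. Proof. by rewrite /lam !amulZr fdZ. Qed.
Let muD x y : mu (x + y) = mu x + mu y. Proof. by rewrite /mu !amulDr feD. Qed.
Let muZ s x : mu (s *: x) = s * mu x. Proof. by rewrite /mu !amulZr feZ. Qed.

(** L_(a+tb)^2 x lies in the line of L_(a+tb)^2 b = d + t e for every t; [pencil] gives the middle
    coefficient from the outer ones. *)
Let mixed x : a ** (b ** x) + b ** (a ** x) = lam x *: e + mu x *: d.
Proof.
have [t|r [r' [r0 -> r'0]]] := @pencil k A d e (lam x *: d)
    (a ** (b ** x) + b ** (a ** x)) (mu x *: e) fde.
  have -> : lam x *: d + t *: (a ** (b ** x) + b ** (a ** x)) + t ^+ 2 *: (mu x *: e)
      = (a + t *: b) ** ((a + t *: b) ** x).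
    by rewrite !amulE (lamE x) (muE x); vring.
  have te : d + t *: e = (a + t *: b) ** ((a + t *: b) ** b).
    by rewrite !amulE !hA !(scaler0, addr0, amul0r).
  rewrite te; apply: free2_line; first exact: rank1.
  rewrite -te; apply/eqP => rel.
  have [/eqP] := free2P fde (etrans (congr1 (fun v => v + _) (scale1r _)) rel).
  by rewrite oner_eq0.
by rewrite (scalev_inj d0 r0) (scalev_inj e0 r'0).
Qed.

Let kernel z := lam z = 0 /\ mu z = 0.

Let kerE z : kernel z ->
  [/\ a ** (a ** z) = 0, b ** (b ** z) = 0 & a ** (b ** z) + b ** (a ** z) = 0].
Proof. by case=> l0 m0; rewrite lamE muE mixed l0 m0 !scale0r addr0. Qed.

(* The line of [(p + s z)^2] contains [(p + s z) (p z) = - s z (z p)]; let [s]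
   tend to 0. *)
Let degenerate_line p q z : p ** (p ** z) = 0 -> z ** (z ** p) != 0 ->
  p ** (p ** q) \in <[z ** (z ** p)]>%VS.
Proof.
move=> pz zp.
have [] // := @memv_cofinite3 k A <[z ** (z ** p)]>%VS [:: 0] (p ** (p ** q))
  (p ** (z ** q) + z ** (p ** q)) (z ** (z ** q)) => s; rewrite inE => s0.
have -> : p ** (p ** q) + s *: (p ** (z ** q) + z ** (p ** q)) + s ^+ 2 *: (z ** (z ** q))
    = (p + s *: z) ** ((p + s *: z) ** q) by rewrite !amulE; vring.
have zE : (p + s *: z) ** ((p + s *: z) ** z) = (- s) *: (z ** (z ** p)).
  by rewrite !amulE pz hA !amul0r (amulC hA p z) !amulE; vring.
have nz : (p + s *: z) ** ((p + s *: z) ** z) != 0.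
  by rewrite zE scaler_eq0 oppr_eq0 negb_or s0.
have := free2_line (rank1 (p + s *: z) z q) nz; rewrite zE => /vlineP[r ->].
by rewrite !memvZ // memv_line.
Qed.

(** Otherwise [degenerate_line] with p = a, b, a + b would put two of d, e, d + e, hence both d and
    e, into one line. *)
Let kernel_square z : kernel z -> z ** (z ** a) = 0 /\ z ** (z ** b) = 0.
Proof.
move=> kz; have [az bz abz] := kerE kz.
have pz : (a + b) ** ((a + b) ** z) = 0.
  by rewrite !amulE az bz add0r addr0.
have da w : w = z ** (z ** a) -> w != 0 -> d \in <[w]>%VS.
  by move=> -> w0; apply: (degenerate_line b az w0).
have eb w : w = z ** (z ** b) -> w != 0 -> e \in <[w]>%VS.
  by move=> -> w0; have := degenerate_line a bz w0; rewrite bba memvN.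
have dab w : w = z ** (z ** (a + b)) -> w != 0 -> d + e \in <[w]>%VS.
  move=> -> w0; have := degenerate_line b pz w0.
  by rewrite !(amulE, hA, amul0r, addr0).
have za0 : z ** (z ** a) = 0.
  apply/eqP; apply: contraT => w0; have dw := da _ erefl w0.
  have zb0 : z ** (z ** b) = 0.
    apply/eqP; apply: contraT => w'0; have ew := eb _ erefl w'0.
    have /vlineP[r rE] := free2_line (rank1 z a b) w0.
    case: (nline dw); rewrite rE in ew; case/vlineP: ew => r' ->.
    by rewrite !memvZ // memv_line.
  have := dab (z ** (z ** a)); rewrite !amulDr zb0 addr0 => /(_ erefl w0) dew.
  by case: (nline dw); rewrite -[e](addKr d) addrC memvB.
split=> //; apply/eqP; apply: contraT => w0; have ew := eb _ erefl w0.
have := dab (z ** (z ** b)); rewrite !amulDr za0 add0r => /(_ erefl w0) dew.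
by case: (nline _ ew); rewrite -[d](addrK e) memvB.
Qed.

(** The linear coefficient of L_(a + s z)^2 b in [s]. *)
Let v0 z := z ** c + a ** (z ** b).

(* [p] is a combination of [a] and [b], and [q] another one with [p q = c]. *)
Let kernel_pencil p q w z x : kernel z -> p ** q = c -> p ** c = w ->
    p ** (z ** q) = a ** (z ** b) -> p ** (p ** x) = 0 -> z ** (z ** q) = 0 ->
  forall s, w + s *: v0 z != 0 ->
  0 + s *: (p ** (z ** x) + z ** (p ** x)) + s ^+ 2 *: (z ** (z ** x))
    \in <[w + s *: v0 z]>%VS.
Proof.
move=> kz pq pc pzq px zq s.
have -> : w + s *: v0 z = (p + s *: z) ** ((p + s *: z) ** q).
  by rewrite !amulE pq pc zq pzq /v0; vring.
have -> : 0 + s *: (p ** (z ** x) + z ** (p ** x)) + s ^+ 2 *: (z ** (z ** x))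
    = (p + s *: z) ** ((p + s *: z) ** x) by rewrite !amulE px; vring.
exact: free2_line.
Qed.

(** For each of p = a, b, a + b the lines of [kernel_pencil] yield a factor, unless [v0 z] is in the
    line of pc; the work is to show that one r serves all. *)
Let kernel_product z x : kernel z -> kernel x ->
  exists r, [/\ z ** (z ** x) = r *: v0 z,
    a ** (z ** x) + z ** (a ** x) = r *: d &
    b ** (z ** x) + z ** (b ** x) = r *: e].
Proof.
move=> kz kx; have [az bz abz] := kerE kz; have [ax bx abx] := kerE kx.
have [za zb] := kernel_square kz.
have bza : b ** (z ** a) = - (a ** (z ** b)).
  rewrite (amulC hA z a) (amulC hA z b) !amulNr opprK; apply: (eq_combine (esym abz)).
  vring.
have bzb : b ** (z ** b) = 0 by rewrite (amulC hA z b) amulNr bz oppr0.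
have pa := kernel_pencil kz (erefl c) (erefl d) erefl ax zb.
have pb s : e + s *: v0 z != 0 ->
    0 + s *: (b ** (z ** x) + z ** (b ** x)) + s ^+ 2 *: (z ** (z ** x)) \in <[e + s *: v0 z]>%VS.
  apply: (kernel_pencil (q := - a)) => //; rewrite ?amulNr ?(amulC hA b a) ?opprK //.
    by rewrite bza opprK.
  by rewrite za oppr0.
have pab s : d + e + s *: v0 z != 0 ->
    0 + s *: ((a + b) ** (z ** x) + z ** ((a + b) ** x)) + s ^+ 2 *: (z ** (z ** x))
      \in <[(d + e) + s *: v0 z]>%VS.
  apply: (kernel_pencil (q := b)) => //; rewrite ?amulDl ?hA ?addr0 //.
  - by rewrite bzb addr0.
  by rewrite !amulDr ax bx add0r addr0.
have Bab : (a + b) ** (z ** x) + z ** ((a + b) ** x)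
    = a ** (z ** x) + z ** (a ** x) + (b ** (z ** x) + z ** (b ** x)).
  by rewrite !amulE; vring.
rewrite {}Bab in pab.
set R := z ** (z ** x) in pa pb pab *.
set Ba := a ** (z ** x) + z ** (a ** x) in pa pab *.
set Bb := b ** (z ** x) + z ** (b ** x) in pb pab *.
(* If v0 z = 0, then z(zx) lies in the lines of d and of e, so it is 0, and the line of d + e makes
   the two factors equal. *)
have [v00|vn0] := eqVneq (v0 z) 0.
  have flat w B : w != 0 ->
      (forall s, w + s *: v0 z != 0 -> 0 + s *: B + s ^+ 2 *: R \in <[w + s *: v0 z]>%VS) ->
      B \in <[w]>%VS /\ R \in <[w]>%VS.
    move=> w0 h; have h' s : s \notin [::] -> 0 + s *: B + s ^+ 2 *: R \in <[w]>%VS.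
      by move=> _; have := h s; rewrite v00 scaler0 addr0; apply.
    by have [_ ? ?] := memv_cofinite3 h'.
  have [/vlineP[r Ba_r] Rd] := flat _ _ d0 pa.
  have [/vlineP[r' Bb_r] Re] := flat _ _ e0 pb.
  have R0 : R = 0.
    apply/eqP; apply: contraT => R0.
    by case: (nline (line_eq Rd R0) (line_eq Re R0)).
  have de0 : d + e != 0.
    apply/eqP => rel; have := @free2P _ _ d e 1 1 fde.
    by rewrite !scale1r => /(_ rel)[/eqP]; rewrite oner_eq0.
  have [/vlineP[r'' Bab_r] _] := flat _ _ de0 pab.
  have [|e1 e2] := free2P (p := r - r'') (q := r' - r'') fde.
    have -> : (r - r'') *: d + (r' - r'') *: e = r *: d + r' *: e - r'' *: (d + e) by vring.
    by rewrite -Bab_r Ba_r Bb_r subrr.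
  have rE : r = r'' by apply/eqP; rewrite -subr_eq0 e1.
  have rE' : r' = r'' by apply/eqP; rewrite -subr_eq0 e2.
  by exists r''; rewrite R0 v00 scaler0 Ba_r Bb_r rE rE'.
have sharp w B : w != 0 -> v0 z \notin <[w]>%VS ->
    (forall s, w + s *: v0 z != 0 -> 0 + s *: B + s ^+ 2 *: R \in <[w + s *: v0 z]>%VS) ->
    exists r, B = r *: w /\ R = r *: v0 z.
  move=> w0 nv h; have fr := free2_of_notin w0 nv.
  have [s|r [r' [/esym/eqP r0 Br Rr]]] := @pencil k A w (v0 z) 0 B R fr.
    apply: h; apply/eqP => rel; have := @free2P _ _ w (v0 z) 1 s fr.
    by rewrite scale1r => /(_ rel)[/eqP]; rewrite oner_eq0.
  exists r'; split=> //; rewrite Br.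
  by move: r0; rewrite scaler_eq0 (negPf w0) orbF => /eqP->; rewrite scale0r add0r.
have same r r' : R = r *: v0 z -> R = r' *: v0 z -> r = r'.
  by move=> -> ; apply: scalev_inj.
have de_line w : w != 0 -> v0 z \in <[w]>%VS -> w \in <[v0 z]>%VS.
  by move=> _ vw; apply: line_eq vw vn0.
have de0 : d + e != 0.
  apply/eqP => rel; have := @free2P _ _ d e 1 1 fde.
  by rewrite !scale1r => /(_ rel)[/eqP]; rewrite oner_eq0.
(* A nonzero [v0 z] lies in at most one of the lines of d, e, d + e. Two others have the same
   factor, read off from R = r v0, and the remaining identity follows by additivity. *)
have [vd|nvd] := boolP (v0 z \in <[d]>%VS); last first.
  have [r [Ba_r Rr]] := sharp _ _ d0 nvd pa; exists r; split=> //.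
  have [ve|nve] := boolP (v0 z \in <[e]>%VS); last first.
    by have [r' [-> Rr']] := sharp _ _ e0 nve pb; rewrite (same _ _ Rr Rr').
  have nvde : v0 z \notin <[(d + e)%R]>%VS.
    apply/negP => vde; have ev := de_line _ e0 ve; have dev := de_line _ de0 vde.
    by apply: (nline _ ev); rewrite -[d](addrK e) memvB.
  have [r' [Bab_r Rr']] := sharp _ _ de0 nvde pab.
  rewrite (same _ _ Rr Rr') in Ba_r *.
  by rewrite -[LHS](addKr Ba) Bab_r Ba_r; vring.
have dv := de_line _ d0 vd.
have nve : v0 z \notin <[e]>%VS.
  by apply/negP => ve; apply: (nline dv); apply: de_line.
have nvde : v0 z \notin <[(d + e)%R]>%VS.
  apply/negP => vde; have dev := de_line _ de0 vde.
  by apply: (nline dv); rewrite -[e](addKr d) addrC memvB.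
have [r [Bb_r Rr]] := sharp _ _ e0 nve pb; exists r; split=> //.
have [r' [Bab_r Rr']] := sharp _ _ de0 nvde pab.
rewrite (same _ _ Rr Rr') in Bb_r *.
by rewrite -[LHS](addrK Bb) Bab_r Bb_r; vring.
Qed.

(** The projection to the kernel along a and b; the signs come from mu a = -1 and lam b = 1. *)
Let prj x := x + mu x *: a - lam x *: b.

Let prjK x : kernel (prj x).
Proof.
have N1 y : - y = (- 1) *: y by rewrite scaleN1r.
by rewrite /kernel /prj N1 !(lamD, muD, lamZ, muZ) lama lamb mua mub; split; ring.
Qed.

Let prjE x : x = - mu x *: a + lam x *: b + prj x.
Proof. by rewrite /prj; vring. Qed.

Let prjD x y : prj (x + y) = prj x + prj y.
Proof. by rewrite /prj lamD muD; vring. Qed.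

Let prjZ s x : prj (s *: x) = s *: prj x.
Proof. by rewrite /prj lamZ muZ; vring. Qed.

(** The last term makes v a = d; on the kernel this is [v0]. *)
Let v y := a ** (y ** b) + y ** c + mu y *: d.
Let rho z w := fd (a ** (z ** w) + z ** (a ** w)).

Let rho_l s z z' w : rho (s *: z + z') w = s * rho z w + rho z' w.
Proof. by rewrite /rho -fdZ -fdD; congr (fd _); rewrite !amulE; vring. Qed.

Let rho_r s z w w' : rho z (s *: w + w') = s * rho z w + rho z w'.
Proof. by rewrite /rho -fdZ -fdD; congr (fd _); rewrite !amulE; vring. Qed.

(** An alternating form: the determinant of [lam] and [mu] on the span of a and b, plus [rho] on the
    kernel. *)
Let phi y x := lam y * mu x - mu y * lam x + rho (prj y) (prj x).

Let vE y : v y = - mu y *: d + lam y *: e + v0 (prj y).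
Proof.
rewrite {1}/v {1 2}(prjE y) /v0 !amulE hA.
by rewrite amul0r; vring.
Qed.

(** Decompose y and x along a, b and the kernel, and compute L_y^2 on a, on b and on the kernel part
    of x. *)
Let square_prj y x : y ** (y ** x) = phi y x *: v y.
Proof.
have phiE : phi y x = lam y * mu x - mu y * lam x + rho (prj y) (prj x) by [].
move: phiE (prjE y) (prjE x) (vE y) (prjK y) (prjK x).
move: (prj y) (prj x) => z w phiE yE xE vyE kz kw.
have [az bz abz] := kerE kz; have [aw bw abw] := kerE kw.
have [za zb] := kernel_square kz.
have [r [zw azw bzw]] := kernel_product kz kw.
rewrite /rho azw fdZ fdd mulr1 in phiE.
have ba : b ** a = - c by rewrite (amulC hA b a).
have aza : a ** (z ** a) = 0 by rewrite (amulC hA z) amulNr az oppr0.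
have bzb : b ** (z ** b) = 0 by rewrite (amulC hA z) amulNr bz oppr0.
have bza : b ** (z ** a) = - (a ** (z ** b)).
  rewrite (amulC hA z a) (amulC hA z b) !amulNr opprK.
  by apply: (eq_combine (esym abz)); vring.
have ya : y ** (y ** a) = - lam y *: v y.
  by rewrite vyE {1 2}yE !amulE hA ba !amulE aza bza za /v0 amul0r; vring.
have yb : y ** (y ** b) = - mu y *: v y.
  by rewrite vyE {1 2}yE !amulE hA bzb zb /v0 amul0r; vring.
have yw : y ** (y ** w) = r *: v y.
  have rel : y ** (y ** w) = mu y ^+ 2 *: (a ** (a ** w)) +
     lam y ^+ 2 *: (b ** (b ** w)) - (mu y * lam y) *: (a ** (b ** w) + b ** (a ** w))
     - mu y *: (a ** (z ** w) + z ** (a ** w))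
     + lam y *: (b ** (z ** w) + z ** (b ** w)) + z ** (z ** w).
    by rewrite {1 2}yE !amulE; vring.
  by rewrite rel aw bw abw azw bzw zw vyE; vring.
by rewrite phiE {1}xE !amulE ya yb yw; vring.
Qed.

Lemma square_factorization : exists (phi : A -> A -> k) (v : A -> A),
  [/\ (forall s x y z, phi (s *: x + y) z = s * phi x z + phi y z)
        /\ (forall s x y z, phi z (s *: x + y) = s * phi z x + phi z y),
      forall x, phi x x = 0,
      linear v,
      forall y x, y ** (y ** x) = phi y x *: v y &
      free [:: v a; v b]].
Proof.
exists phi, v; split.
- split=> s x y z; rewrite /phi lamD lamZ muD muZ prjD prjZ.
    by rewrite rho_l; ring.
  by rewrite rho_r; ring.
- move=> x; rewrite /phi /rho hA amul0r add0r (amulC hA a) amulNr.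
  have [-> _] := kernel_square (prjK x).
  by rewrite oppr0 -(scale0r 0) fdZ; ring.
- by move=> s x y; rewrite /v !(muD, muZ, amulE); vring.
- exact: square_prj.
have -> : v a = d by rewrite /v mua; vring.
by have -> : v b = e by rewrite /v mub hA amul0r scale0r add0r addr0.
Qed.

End Config.

(** * Nilpotency from the factorisation *)

Section Factorized.
Variables (k : closedFieldType) (A : algebra k).
Hypotheses (hA : anticommutative A) (eA : engel A).
Local Notation "x ** y" := (mul A x y) (at level 40, left associativity).
Hypothesis cube0 : forall a x, a ** (a ** (a ** x)) = 0.
Local Notation amulE := (@amulDl k A, @amulDr k A, @amulZl k A, @amulZr k A,
  @amulNl k A, @amulNr k A).

Variables (phi : A -> A -> k) (v : A -> A).
Hypothesis phi_l : forall s x y z, phi (s *: x + y) z = s * phi x z + phi y z.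
Hypothesis phi_r : forall s x y z, phi z (s *: x + y) = s * phi z x + phi z y.
Hypothesis phixx : forall x, phi x x = 0.
Hypothesis v_linear : linear v.
Hypothesis squareE : forall y x, y ** (y ** x) = phi y x *: v y.
Variables (a b : A).
Hypotheses (phiab : phi a b != 0) (vab : free [:: v a; v b]).

Let phiDl x y z : phi (x + y) z = phi x z + phi y z.
Proof. by have := phi_l 1 x y z; rewrite scale1r mul1r. Qed.

Let phiDr x y z : phi z (x + y) = phi z x + phi z y.
Proof. by have := phi_r 1 x y z; rewrite scale1r mul1r. Qed.

Let phi0r x : phi x 0 = 0.
Proof. by apply: (addrI (phi x 0)); rewrite -phiDr !addr0. Qed.

Let phi0l x : phi 0 x = 0.
Proof. by apply: (addrI (phi 0 x)); rewrite -phiDl !addr0. Qed.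

Let phiZl s x y : phi (s *: x) y = s * phi x y.
Proof. by rewrite -[s *: x]addr0 phi_l phi0l addr0. Qed.

Let phiZr s x y : phi x (s *: y) = s * phi x y.
Proof. by rewrite -[s *: y]addr0 phi_r phi0r addr0. Qed.

Let phiC x y : phi x y = - phi y x.
Proof.
apply/eqP; rewrite -addr_eq0; have := phixx (x + y).
by rewrite phiDl !phiDr !phixx add0r addr0 => ->.
Qed.

Let vD x y : v (x + y) = v x + v y.
Proof. by have := v_linear 1 x y; rewrite !scale1r. Qed.

Let v_0 : v 0 = 0.
Proof. by apply: (addrI (v 0)); rewrite -vD !addr0. Qed.

Let vZ s x : v (s *: x) = s *: v x.
Proof. by rewrite -[s *: x]addr0 v_linear v_0 addr0. Qed.

Let vN x : v (- x) = - v x.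
Proof. by rewrite -scaleN1r vZ scaleN1r. Qed.

(** The cube of L_(a + s x) at b is phi(a + s x, b) times (a + s x) v(a + s x); the scalar is
    nonzero at s = 0 and cancels. *)
Let mul_v x : x ** v x = 0.
Proof.
have [|_ _ //] := @scale_cancel k A (phi a b) (phi x b) 0 (a ** v a)
  (a ** v x + x ** v a) (x ** v x) phiab.
move=> s; have := cube0 (a + s *: x) b; rewrite (squareE _ b) amulZr phiDl phiZl vD vZ => e.
by rewrite -[RHS]e !amulE; vring.
Qed.

Let mul_vC x y : x ** v y + y ** v x = 0.
Proof.
have := mul_v (x + y); rewrite vD amulDl !amulDr !mul_v addr0 add0r.
by [].
Qed.

Let square_linear x y z :
  x ** (y ** z) + y ** (x ** z) = phi x z *: v y + phi y z *: v x.
Proof.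
have := squareE (x + y) z; rewrite phiDl vD !amulE !squareE => e.
by apply: (eq_combine e); vring.
Qed.

(** Subtracting two polarised identities for x(z(xy)) puts phi(x, xy) v(z) into the line of v(x) for
    all z; a nonzero scalar would put v(a) and v(b) into one line. *)
Let phi_mul x y : phi x (x ** y) = 0.
Proof.
have rel z : phi x (x ** y) *: v z = - (phi x (z ** y) + phi z (x ** y)) *: v x.
  have e1 := square_linear x z (x ** y); rewrite squareE amulZr in e1.
  have e2 := congr1 (mul A x) (square_linear x z y).
  rewrite !amulDr !amulZr squareE mul_v scaler0 addr0 in e2.
  have e : x ** (z ** (x ** y)) + phi x y *: (z ** v x) + phi x y *: 0
     = phi x (x ** y) *: v z + phi z (x ** y) *: v x + phi x y *: (x ** v z + z ** v x).
    by rewrite e1 mul_vC.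
  have e' := congr2 +%R e (esym e2).
  by apply: (eq_combine (esym e')); vring.
apply/eqP; apply: contraT => p0.
have line z : v z \in <[v x]>%VS.
  by rewrite -(scalerK p0 (v z)) rel !memvZ // memv_line.
have /vlineP[p pE] := line a; have /vlineP[q qE] := line b.
have vx0 : v x != 0.
  apply: contraTneq vab => vx0; rewrite free_cons negb_and negbK pE vx0 scaler0.
  by rewrite mem0v.
have [|q0 /eqP] := free2P (p := q) (q := - p) vab.
  by rewrite pE qE !scalerA mulNr scaleNr mulrC subrr.
rewrite oppr_eq0 => /eqP p00.
by move: vab; rewrite free_cons pE p00 scale0r mem0v.
Qed.

(** [square_linear] at zw, z, w gives the identity times phi(z, w); along (a + s x, b + s y) this
    factor is nonzero at s = 0 and cancels. *)
Let v_mul x y : v (x ** y) = - (x ** v y).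
Proof.
have rel z w : phi z w *: (v (z ** w) + z ** v w) = 0.
  have e := square_linear (z ** w) z w.
  rewrite hA add0r in e.
  have zw_w : (z ** w) ** w = - (phi z w *: v w).
    rewrite (amulC hA (z ** w)) (amulC hA z w) amulNr opprK squareE.
    by rewrite (phiC w z) scaleNr.
  have p0 : phi (z ** w) w = 0 by rewrite phiC (amulC hA z) -scaleN1r phiZr phi_mul mulr0 oppr0.
  rewrite zw_w p0 scale0r add0r amulNr amulZr in e.
  by rewrite scalerDr -e addNr.
have [|_ _ /eqP] := @scale_cancel k A (phi a b) (phi a y + phi x b) (phi x y)
  (v (a ** b) + a ** v b) (v (a ** y) + a ** v y + (v (x ** b) + x ** v b))
  (v (x ** y) + x ** v y) phiab.
  move=> s; have := rel (a + s *: x) (b + s *: y).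
  rewrite !(phiDl, phiDr, phiZl, phiZr) !amulE !(vD, vZ) !amulE => e.
  by rewrite -[RHS]e; vring.
by rewrite addr_eq0 => /eqP.
Qed.

(** Evaluating z(z v(w)) in two ways gives [swap]. If the claim fails, v(x) is an eigenvector of v,
    and the Engel condition makes phi(v(x), z) = 0 for all z; polarising [diag] moves v between the
    arguments of phi. *)
Let v_v x y : phi x y *: v (v x) = 0.
Proof.
have swap z w : phi z (v w) *: v z = phi z w *: v (v z).
  by rewrite -squareE -[z ** v w]opprK -v_mul amulNr -v_mul squareE vZ.
have [->|p0] := eqVneq (phi x y) 0; first by rewrite scale0r.
have [->|vv0] := eqVneq (v (v x)) 0; first by rewrite scaler0.
have u0 : v x != 0 by apply: contraNneq vv0 => ->; rewrite v_0.
pose kap := phi x (v y) / phi x y.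
have vvE : v (v x) = kap *: v x.
  by rewrite -(scalerK p0 (v (v x))) -swap scalerA mulrC.
have kap0 : kap != 0 by apply: contraNneq vv0 => k0; rewrite vvE k0 scale0r.
have phiu z : phi (v x) z = 0.
  have : v x ** (v x ** z) = (phi (v x) z * kap) *: v x by rewrite squareE vvE scalerA.
  case/(engel_notin_image hA eA) => [/eqP|u00]; last by rewrite u00 eqxx in u0.
  by rewrite mulf_eq0 (negPf kap0) orbF => /eqP.
have diag z : phi z (v z) *: v z = 0 by rewrite swap phixx scale0r.
have px0 : phi x (v x) = 0.
  by have /eqP := diag x; rewrite scaler_eq0 (negPf u0) orbF => /eqP.
have pxy : phi x (v y) = - phi y (v x).
  have h s : s \notin [::] -> 0 + s *: ((phi x (v y) + phi y (v x)) *: v x)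
      + s ^+ 2 *: (phi y (v y) *: v x + (phi x (v y) + phi y (v x)) *: v y)
      + s ^+ 3 *: (phi y (v y) *: v y) + s ^+ 4 *: 0 \in (0%VS : {vspace A}).
    move=> _; rewrite memv0; apply/eqP; rewrite -[RHS](diag (x + s *: y)).
    by rewrite !(vD, vZ, phiDl, phiDr, phiZl, phiZr) px0; vring.
  have [_ + _] := memv_cofinite5 h.
  by rewrite memv0 scaler_eq0 (negPf u0) orbF addr_eq0 => /eqP.
by rewrite -swap pxy phiC phiu !oppr0 scale0r.
Qed.

(** The ideal is the image of v: by [v_mul], L_x^2 v(y) = v(x(xy)) = phi(x, y) v(v(x)) = 0. *)
Lemma nilpotent_of_factorization : nilpotent A.
Proof.
pose U := <<[seq v x | x <- vbasis {:A}]>>%VS.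
have memU x : v x \in U.
  rewrite (coord_vbasis (memvf x)).
  elim/big_rec: _ => [|i y _ yU]; first by rewrite v_0 mem0v.
  rewrite vD vZ memvD // memvZ // memv_span // map_f //.
  by apply: mem_nth; rewrite size_tuple.
have indU (W : {vspace A}) (f : 'End(A)) : (forall x, f (v x) \in W) ->
    forall u, u \in U -> f u \in W.
  move=> fW u uU; suffices /subvP/(_ u uU) : (U <= f @^-1: W)%VS by rewrite -memv_preim.
  by apply/span_subvP => _ /mapP[x _ ->]; rewrite -memv_preim.
apply: (nilpotent_of_ideal hA (U := U)) => [x|x y|x u uU].
- by apply: (indU U (mul A x)) => y; rewrite -[_ ** _]opprK -v_mul -vN memU.
- by rewrite squareE memvZ.
apply/eqP; rewrite -memv0.
have : forall u, u \in U -> (mul A x \o mul A x)%VF u \in 0%VS.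
  apply: indU => y; rewrite comp_lfunE /=.
  rewrite -[x ** v y]opprK -v_mul amulNr -v_mul squareE vZ v_v.
  exact: mem0v.
by move/(_ u uU); rewrite comp_lfunE.
Qed.

End Factorized.

(** * The rank one case and the final case distinction *)

Lemma nilpotent_of_rank1 (k : closedFieldType) (A : algebra k) :
    anticommutative A -> engel A ->
    (forall a x, mul A a (mul A a (mul A a x)) = 0) ->
    (forall a x y, ~~ free [:: mul A a (mul A a x); mul A a (mul A a y)]) ->
  nilpotent A.
Proof.
move=> hA eA cube0 rank1.
have [[a [b fr]]|none] := classic (exists a b : A,
    free [:: mul A a (mul A a b); mul A b (mul A a b)]); last first.
  apply: (nilpotent_of_fixed_line hA cube0 rank1) => x y; apply/negP => fr.
  by apply: none; exists x, y.
have [phi [v [[phi_l phi_r] phixx vl sq vab]]] := square_factorization hA rank1 fr.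
apply: (nilpotent_of_factorization hA eA cube0 phi_l phi_r phixx vl sq _ vab).
apply/eqP => p0; have := free_not0 fr; move=> /(_ (mul A a (mul A a b))).
by rewrite inE eqxx sq p0 scale0r eqxx => /(_ isT).
Qed.

(** In dimension 5 the free chain from a and b is a basis, and L_a^4 kills each member. *)
Lemma dim5_fourth_power (k : fieldType) (A : algebra k) (a b b' : A) :
    \dim {:A} = 5%N -> anticommutative A -> engel A ->
    mul A a (mul A a (mul A a b)) != 0 ->
    mul A a (mul A a (mul A a (mul A a b))) = 0 ->
  mul A a (mul A a (mul A a (mul A a b'))) = 0.
Proof.
move=> dA hA eA bn0 b4; have fr := engel_free_chain hA eA bn0 b4.
have : b' \in <<[:: a; b; mul A a b; mul A a (mul A a b); mul A a (mul A a (mul A a b))]>>%VS.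
  suffices -> : (<<[:: a; b; mul A a b; mul A a (mul A a b); mul A a (mul A a (mul A a b))]>>
    = {:A})%VS by apply: memvf.
  by apply/eqP; rewrite eqEdim subvf dA (eqP fr).
pose f := (mul A a \o (mul A a \o (mul A a \o mul A a)))%VF.
have fE x : f x = mul A a (mul A a (mul A a (mul A a x))) by rewrite !comp_lfunE.
rewrite -fE => b'_in; apply/eqP; rewrite -memv0.
suffices /subvP/(_ b' b'_in) : (<<[:: a; b; mul A a b; mul A a (mul A a b);
    mul A a (mul A a (mul A a b))]>> <= f @^-1: 0)%VS by rewrite -memv_preim.
apply/span_subvP => x; rewrite !inE -memv_preim memv0 fE.
by case/or4P => [/eqP->|/eqP->|/eqP->|/orP[] /eqP->]; rewrite ?hA ?b4 ?amul0r.
Qed.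

Theorem corollary9p9 (k : closedFieldType) (A : algebra k)
    (hanti : anticommutative A) (hengel : engel A)
    (l : nat) (hlevel : is_level A l) (hl : (l <= 5)%N) :
  nilpotent A.
Proof.
apply: NNPP => nA; suffices /hlevel.2 : degeneration_chain 6 A.
  by move/leq_trans/(_ hl).
have [[a [b0 e0]]|cube] := classic (exists a b : A, mul A a (mul A a (mul A a b)) <> 0); last first.
  have cube0 a x : mul A a (mul A a (mul A a x)) = 0.
    by apply: NNPP => n; apply: cube; exists a, x.
  have [[a [x [y fr]]]|none] := classic (exists a x y : A,
      free [:: mul A a (mul A a x); mul A a (mul A a y)]).
    apply: (long_chain_two_blocks hanti nA).
    exact: engel_free_chains fr.
  case: nA; apply: nilpotent_of_rank1 => // a x y; apply/negP => fr.
  by apply: none; exists a, x, y.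
have [b bn0 b4] : exists2 b : A, mul A a (mul A a (mul A a b)) != 0 &
    mul A a (mul A a (mul A a (mul A a b))) = 0.
  have [m _ em] := hengel.
  (* With i least such that L_a^i b0 = 0, the element L_a^(i-4) b0 is killed by L_a^4 but not by
     L_a^3. *)
  have ex0 : exists i, iter i (left_mul a) b0 == 0 by exists m; rewrite em.
  case: (ex_minnP ex0) => i /eqP i0 mini.
  have i4 : (3 < i)%N.
    rewrite ltnNge; apply/negP => le3; apply: e0.
    rewrite -[LHS]/(iter 3 (left_mul a) b0) -(subnK le3) iterD i0.
    by elim: (3 - i)%N => //= j ->; rewrite /left_mul amul0r.
  exists (iter (i - 4) (left_mul a) b0).
    have -> : mul A a (mul A a (mul A a (iter (i - 4) (left_mul a) b0)))
        = iter (i - 1) (left_mul a) b0.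
      by rewrite (_ : i - 1 = 3 + (i - 4))%N ?iterD //; lia.
    by apply/negP => /mini; lia.
  by rewrite -[LHS]/(iter 4 (left_mul a) _) -iterD subnKC.
have fr := engel_free_chain hanti hengel bn0 b4.
have le5 : (5 <= \dim {:A})%N by rewrite -[5%N](eqP fr) dimvS ?subvf.
move: le5; rewrite leq_eqVlt => /predU1P[dA|le6]; last exact: long_chain_dim6 fr.
have [[b' [n0 nin]]|bad] := classic (exists b' : A, mul A a (mul A a (mul A a b')) != 0 /\
    mul A b' (mul A a b') \notin <<[:: a; b'; mul A a b'; mul A a (mul A a b')]>>%VS).
  apply: (long_chain_dim5 hanti nA (esym dA) _ erefl erefl erefl nin).
  apply: engel_free_chain => //.
  exact: (@dim5_fourth_power k A a b b' (esym dA) hanti hengel bn0 b4).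
case: nA; apply: (dim5_nilpotent hanti hengel (esym dA) bn0 b4) => b' n0.
by apply: contraT => nin; case: bad; exists b'.
Qed.
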